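(* There exist constants $D>0$ and $C>0$ depending only on the loss function $\ell$ such that, for all $J\subset\{1,\dots,N\}$ with $d:=d(J)=\mathrm{card}(J)$, for all $A\ge 1$ and for all $$\varepsilon\ \ge\ D\sqrt{\frac{d+A\log N}{n}},$$ the following bounds hold with probability at least $1-N^{-A}$: $$\sum_{j\notin J}\hat\lambda^\varepsilon_j\le C\Bigl[\sum_{j\notin J}\lambda^\varepsilon_j+\sqrt{\frac{d+A\log N}{n}}\Bigr],\qquad \sum_{j\notin J}\lambda^\varepsilon_j\le C\Bigl[\sum_{j\notin J}\hat\lambda^\varepsilon_j+\sqrt{\frac{d+A\log N}{n}}\Bigr]$$ and $$\|f_{\hat\lambda^\varepsilon}-f_{\lambda^\varepsilon}\|^2_{L_2(\Pi)}+\varepsilon K(\hat\lambda^\varepsilon,\lambda^\varepsilon)\le C\Bigl[\frac{d+A\log N}{n}\vee\Bigl(\sum_{j\notin J}\lambda^\varepsilon_j\Bigr)\sqrt{\frac{d+A\log N}{n}}\Bigr].$$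
   Context: Setting. $S,T$ are measurable spaces, $(X,Y)$ is a random couple in $S\times T$ with distribution $P$, $\Pi$ is the distribution of $X$, and $(X_1,Y_1),\dots,(X_n,Y_n)$ are i.i.d. copies of $(X,Y)$ with empirical distribution $P_n$. For a function $g$ on $S\times T$ (or on $S$, viewed as a function on $S\times T$), $Pg=\mathbb E g(X,Y)$ and $P_ng=n^{-1}\sum_{i=1}^n g(X_i,Y_i)$. $h_1,\dots,h_N:S\to[-1,1]$ are given measurable functions (the dictionary). $\Lambda=\{(\lambda_1,\dots,\lambda_N):\lambda_j\ge0,\ \sum_{j=1}^N\lambda_j=1\}$, and $f_\lambda=\sum_{j=1}^N\lambda_jh_j$ for $\lambda\in\mathbb R^N$. Loss. $\ell:T\times\mathbb R\to\mathbb R_+$ is a loss function such that for every $y\in T$ the function $\ell(y,\cdot)$ is convex and twice differentiable (derivatives $\ell'_u,\ell''_u$ in the second variable), $\ell''_u$ is uniformly bounded on $T\times\mathbb R$, $\sup_{y\in T}\ell(y;0)<\infty$ and $\sup_{y\in T}|\ell'_u(y;0)|<\infty$. For $f:S\to\mathbb R$, $(\ell\bullet f)(x,y):=\ell(y,f(x))$. It is assumed that the infimum of $P(\ell\bullet g)$ over all measurable $g:S\to\mathbb R$ is attained at some $f_*\in L_2(\Pi)$ with $\|f_*\|_\infty\le M$ for a constant $M$, and that $\tau(M\vee1)>0$, where $\tau(R):=\frac12\inf_{y\in T}\inf_{|u|\le R}\ell''_u(y,u)$ (without loss of generality $\tau(R)\le 1$ for $R>0$). Estimators. For a regularization parameter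 $\varepsilon$ (with $0\log0=0$), $$\hat\lambda^\varepsilon:=\operatorname*{argmin}_{\lambda\in\Lambda}\Bigl[P_n(\ell\bullet f_\lambda)+\varepsilon\sum_{j=1}^N\lambda_j\log\lambda_j\Bigr],\qquad \lambda^\varepsilon:=\operatorname*{argmin}_{\lambda\in\Lambda}\Bigl[P(\ell\bullet f_\lambda)+\varepsilon\sum_{j=1}^N\lambda_j\log\lambda_j\Bigr].$$ For $\lambda,\nu\in\Lambda$, $K(\lambda|\nu):=\sum_{j=1}^N\lambda_j\log(\lambda_j/\nu_j)$ and $K(\lambda,\nu):=K(\lambda|\nu)+K(\nu|\lambda)$. $a\vee b=\max(a,b)$. Standing assumption: $N\ge(\log n)^\gamma$ for some $\gamma>0$. *)

(* Defs.v *)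
From HB Require Import structures.
From mathcomp Require Export all_boot all_order all_algebra.
From mathcomp Require Export all_classical all_reals all_analysis.

Set Implicit Arguments.
Unset Strict Implicit.
Unset Printing Implicit Defensive.

Export Order.TTheory GRing.Theory Num.Theory numFieldNormedType.Exports.

Local Open Scope classical_set_scope.
Local Open Scope ring_scope.

Section Loss.
Context {R : realType} {d : measure_display} {T : measurableType d}.

Definition loss_d1 (l : T -> R -> R) (y : T) : R -> R := derive1 (l y).
Definition loss_d2 (l : T -> R -> R) (y : T) : R -> R := derive1 (loss_d1 l y).

(* Joint measurability is what makes the risk P (l . f) of a measurable f
   meaningful. *)
Record loss_function (l : T -> R -> R) : Prop := LossFunction {
  loss_measurable : measurable_fun setT (fun p : T * R => l p.1 p.2);
  loss_ge0 : forall y u, 0 <= l y u;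
  loss_convex : forall y, convex_function (E := R^o) setT (l y);
  loss_derivable1 : forall y u, derivable (l y) u 1;
  loss_derivable2 : forall y u, derivable (loss_d1 l y) u 1;
  loss_d2_bounded : exists B : R, forall y u, `|loss_d2 l y u| <= B;
  loss_at0_bounded : exists B : R, forall y, l y 0 <= B;
  loss_d1_at0_bounded : exists B : R, forall y, `|loss_d1 l y 0| <= B
}.

(* For r >= 0 both infima are over nonempty sets bounded below by 0, the loss
   being convex (T is inhabited, as every measurableType). *)
Definition tau (l : T -> R -> R) (r : R) : R :=
  2^-1 * inf [set inf [set loss_d2 l y u | u in [set u | `|u| <= r]] | y in setT].

End Loss.

Section Probability.
Context {R : realType} {dO : measure_display} {Omega : measurableType dO}.
Variable Pr : probability Omega R.

(* The product rule for all families B contains the one for subfamilies, by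
   taking some of the B i to be setT. *)
Definition independent_family {d} {U : measurableType d} (n : nat)
    (Z : 'I_n -> {RV Pr >-> U}) : Prop :=
  forall B : 'I_n -> set U, (forall i, measurable (B i)) ->
    Pr (\bigcap_(i in [set: 'I_n]) (Z i @^-1` B i)) =
    (\prod_(i < n) Pr (Z i @^-1` B i))%E.

Definition iid_sample {d} {U : measurableType d} (P : probability U R)
    (n : nat) (Z : 'I_n -> {RV Pr >-> U}) : Prop :=
  independent_family Z /\
  forall i (B : set U), measurable B -> distribution Pr (Z i) B = P B.

(* Avoids evaluating Pr at a set not known to be measurable. *)
Definition with_probability_ge (p : R) (Q : Omega -> Prop) : Prop :=
  exists E : set Omega,
    [/\ measurable E, (p%:E <= Pr E)%E & forall w, E w -> Q w].

End Probability.

Section Simplex.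
Context {R : realType} {N : nat}.

Definition simplex : set 'rV[R]_N :=
  [set lam | (forall j, 0 <= lam ord0 j) /\ \sum_(j < N) lam ord0 j = 1].

(* 0 log 0 = 0, as ln 0 = 0. *)
Definition neg_entropy (lam : 'rV[R]_N) : R :=
  \sum_(j < N) lam ord0 j * ln (lam ord0 j).

(* a log (a / b), with the conventions 0 log (0 / b) = 0 and
   a log (a / 0) = +oo for a > 0. *)
Definition kl_term (a b : R) : \bar R :=
  if a == 0 then 0%E else if b == 0 then +oo%E else (a * ln (a / b))%:E.

Definition KL (lam nu : 'rV[R]_N) : \bar R :=
  (\sum_(j < N) kl_term (lam ord0 j) (nu ord0 j))%E.

Definition sym_KL (lam nu : 'rV[R]_N) : \bar R := (KL lam nu + KL nu lam)%E.

Definition is_argmin_simplex (F : 'rV[R]_N -> \bar R) (lam : 'rV[R]_N) : Prop :=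
  simplex lam /\ forall nu, simplex nu -> (F lam <= F nu)%E.

Definition mass_outside (J : {set 'I_N}) (lam : 'rV[R]_N) : R :=
  \sum_(j < N | j \notin J) lam ord0 j.

Definition mixture {S : Type} (h : 'I_N -> S -> R) (lam : 'rV[R]_N) : S -> R :=
  fun x => \sum_(j < N) lam ord0 j * h j x.

End Simplex.

Section Learning.
Context {R : realType} {dS dT : measure_display}.
Context {S : measurableType dS} {T : measurableType dT}.

Definition loss_comp (l : T -> R -> R) (f : S -> R) : S * T -> R :=
  fun z => l z.2 (f z.1).

Definition risk (P : probability (S * T)%type R) (l : T -> R -> R)
    (f : S -> R) : \bar R :=
  (\int[P]_z (loss_comp l f z)%:E)%E.

Definition empirical_mean {n : nat} (z : 'I_n -> S * T) (g : S * T -> R) : R :=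
  n%:R^-1 * \sum_(i < n) g (z i).

Definition proj_input : S * T -> S := fst.

HB.instance Definition _ :=
  isMeasurableFun.Build _ _ _ _ proj_input measurable_fst.

Definition marginal (P : probability (S * T)%type R) : probability S R :=
  distribution P proj_input.

(* Membership in Lfun includes measurability of fstar; 'N_(+oo) is the
   essential supremum norm. *)
Definition bayes_condition (P : probability (S * T)%type R) (l : T -> R -> R)
    (fstar : S -> R) (M : R) : Prop :=
  [/\ fstar \in Lfun (marginal P) 2%:E,
      forall g : S -> R, measurable_fun setT g ->
        (risk P l fstar <= risk P l g)%E,
      ('N[marginal P]_(+oo) [EFin \o fstar] <= M%:E)%E &
      0 < tau l (Num.max M 1)].

Context {N : nat}.

Definition penalized_risk (P : probability (S * T)%type R) (l : T -> R -> R)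
    (h : 'I_N -> S -> R) (eps : R) (lam : 'rV[R]_N) : \bar R :=
  (risk P l (mixture h lam) + (eps * neg_entropy lam)%:E)%E.

Definition penalized_empirical_risk {n : nat} (z : 'I_n -> S * T)
    (l : T -> R -> R) (h : 'I_N -> S -> R) (eps : R) (lam : 'rV[R]_N) : \bar R :=
  (empirical_mean z (loss_comp l (mixture h lam)) + eps * neg_entropy lam)%:E.

End Learning.

(* Main.v *)
Require Import Defs.
From mathcomp Require Import measurable_realfun.
From mathcomp Require Import zify ring lra.

(** Write [f_lambda] for the mixture, [r] for the square root of the rate and
    [w] for the difference of the two minimizers.  Adding the first-order
    conditions of the two penalized problems and using that the derivative of
    the loss is strongly monotone on [-1, 1], with constant [a], gives
      [a P_n f_w^2 + eps K <= (P - P_n) (g f_w)],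
    where [K] is the symmetrized divergence and [g], the derivative of the loss
    at the population minimizer, is not random.  So only processes [X_w = (P_n - P) (g f_w)] that are linear
    in [w] have to be controlled: [f_w^2 = sum_j w_j h_j f_w] reduces the
    quadratic term to the same processes with [g] replaced by [h_j].

    To bound [X_w], split [w] along [J].  Outside [J], the [N] numbers
    [X_(e_j)] are [O(r)] by Chernoff's bound.  Inside [J], the unit ball of the
    norm [max (|v|_1 / 2) (|f_v|_2 / r)] has a half-net, for that same norm, with
    at most [22 ^ #|J|] points; at each of them [X] is [O(r ^ 2)], hence so it is
    on the whole ball, and by homogeneity [X_v = O(r |f_v|_2 + r ^ 2)]
    everywhere.  This replaces chaining, symmetrization and peeling.

    The cardinality of the net comes from a pigeonhole argument on a fine
    lattice: two lattice points of a symmetric convex body that are congruent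
    modulo [m] differ by [m] times a lattice point of the [2 / m]-dilation. *)

Set Implicit Arguments.
Unset Strict Implicit.
Unset Printing Implicit Defensive.

Local Open Scope classical_set_scope.
Local Open Scope ring_scope.

(** * Independence and Chernoff's bound *)

Section Weighted.
Local Open Scope ereal_scope.
Import HBNNSimple.

(** The hypothesis is the case of indicators: the measure with density [Y] has image [nu] under [Z].
    Linearity extends it to simple functions, and monotone convergence to every nonnegative
    measurable [phi]. *)
Lemma ge0_integral_weighted_pushforward {R : realType} {d d'}
    {Omega : measurableType d} {U : measurableType d'}
    (mu : {measure set Omega -> \bar R}) (nu : {measure set U -> \bar R})
    (Z : Omega -> U) (Y : Omega -> R) (phi : U -> R) :
  measurable_fun setT Z -> measurable_fun setT Y -> (forall w, 0 <= Y w)%R ->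
  (forall B, measurable B -> \int[mu]_(w in Z @^-1` B) (Y w)%:E = nu B) ->
  measurable_fun setT phi -> (forall u, 0 <= phi u)%R ->
  \int[mu]_w (Y w * phi (Z w))%:E = \int[nu]_u (phi u)%:E.
Proof.
move=> mZ mY Y0 H mphi phi0.
have mEphi : measurable_fun [set: U] (EFin \o phi) by exact/measurable_EFinP.
have Ephi0 u : setT u -> 0 <= (EFin \o phi) u by rewrite /= lee_fin.
pose f_ := nnsfun_approx measurableT mEphi.
have ndf := nd_nnsfun_approx measurableT mEphi.
have cf u : (f_^~ u n)%:E @[n --> \oo] --> (phi u)%:E.
  by apply: cvg_nnsfun_approx.
have mfZ n : measurable_fun setT (f_ n \o Z).
  by apply: measurableT_comp => //; exact: measurable_funP.
transitivity (limn (fun n => \int[mu]_w (Y w * f_ n (Z w))%:E)).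
  rewrite -monotone_convergence//.
  - apply: eq_integral => w _; apply/esym/cvg_lim => //.
    under eq_fun do rewrite EFinM.
    by rewrite EFinM; apply: cvgeZl.
  - move=> n; apply/measurable_EFinP; apply: measurable_funM; [exact: mY|exact: mfZ].
  - by move=> n w _; rewrite lee_fin mulr_ge0.
  - move=> w _ m n mn; rewrite lee_fin ler_wpM2l//.
    exact/lefP/ndf.
transitivity (limn (fun n => \int[nu]_u (f_ n u)%:E)); last first.
  rewrite -monotone_convergence//.
  - by apply: eq_integral => u _; apply/cvg_lim.
  - by move=> n; apply/measurable_EFinP; exact: measurable_funP.
  - by move=> n w _; rewrite lee_fin.
  - by move=> w _ m n mn; rewrite lee_fin; exact/lefP/ndf.
congr (limn _); apply/funext => n.
have mpre k : measurable (Z @^-1` (f_ n @^-1` [set k])).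
  by rewrite -[X in measurable X]setTI; apply: mZ => //; exact: measurable_sfunP.
transitivity (\sum_(k \in range (f_ n))
    \int[mu]_w (k * (Y w * \1_(Z @^-1` (f_ n @^-1` [set k])) w))%:E).
  rewrite -ge0_integral_fsum//; last first.
  - move=> k w _; rewrite lee_fin.
    have [k0|k0] := leP 0%R k; first by rewrite !mulr_ge0.
    by rewrite preimage_nnfun0// preimage_set0 indic0 mulr0 mulr0.
  - move=> k; apply/measurable_EFinP; apply: measurable_funM => //.
    by apply: measurable_funM => //; exact: measurable_indic.
  apply: eq_integral => w _; rewrite fimfunE fsumEFin// -fsumEFin//.
    rewrite EFinM -fsumEFin// ge0_mule_fsumr//; last first.
      by move=> k; exact: nnfun_muleindic_ge0.
    by apply: eq_fsbigr => k _; rewrite -EFinM mulrCA.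
transitivity (\sum_(k \in range (f_ n))
    \int[nu]_u (k * \1_(f_ n @^-1` [set k]) u)%:E); last first.
  rewrite -ge0_integral_fsum//.
  - by apply: eq_integral => x _; rewrite fsumEFin// -fimfunE.
  - by move=> r; exact/measurable_EFinP/measurable_funM.
  - by move=> r x _; rewrite nnfun_muleindic_ge0.
apply: eq_fsbigr => k.
rewrite inE => -[u _ <-]; rewrite integralZl_indic_nnsfun// integral_indic// setIT -H//.
under eq_integral do rewrite EFinM.
rewrite ge0_integralZl//; last 3 first.
- apply/measurable_EFinP; apply: measurable_funM => //; exact: measurable_indic.
- by move=> w _; rewrite lee_fin mulr_ge0.
- by rewrite lee_fin.
congr (_ * _); rewrite [RHS]integral_mkcond; apply: eq_integral => w _.
by rewrite epatch_indic /= EFinM.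
Qed.

End Weighted.

(** * Bounded measurable functions and their means *)

Section BoundedMeasurable.
Context {R : realType} {d : measure_display} {T : measurableType d}.
Implicit Types f g : T -> R.

(** The bound holds at every point, so that it also applies at sample points. The class is closed
    under sums and products, and its members are integrable for every probability. *)
Definition bounded_measurable f :=
  measurable_fun setT f /\ exists c : R, forall x, `|f x| <= c.

Lemma bounded_measurable_cst (c : R) : bounded_measurable (fun=> c).
Proof. by split; [exact: measurable_cst|exists `|c|]. Qed.

Lemma bounded_measurableD f g : bounded_measurable f -> bounded_measurable g ->
  bounded_measurable (fun x => f x + g x).
Proof.
move=> [mf [a fa]] [mg [b gb]]; split; first exact: measurable_funD.
by exists (a + b) => x; rewrite (le_trans (ler_normD _ _))// lerD.
Qed.

Lemma bounded_measurableM f g : bounded_measurable f -> bounded_measurable g ->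
  bounded_measurable (fun x => f x * g x).
Proof.
move=> [mf [a fa]] [mg [b gb]]; split; first exact: measurable_funM.
by exists (a * b) => x; rewrite normrM ler_pM.
Qed.

Lemma bounded_measurableZ (c : R) f : bounded_measurable f ->
  bounded_measurable (fun x => c * f x).
Proof. exact/bounded_measurableM/bounded_measurable_cst. Qed.

Lemma bounded_measurableN f : bounded_measurable f ->
  bounded_measurable (fun x => - f x).
Proof.
move=> [mf [a fa]]; split; first exact: measurable_funN.
by exists a => x; rewrite normrN.
Qed.

Lemma bounded_measurableB f g : bounded_measurable f -> bounded_measurable g ->
  bounded_measurable (fun x => f x - g x).
Proof. by move=> bf bg; apply/bounded_measurableD/bounded_measurableN. Qed.

Lemma bounded_measurable_sum (I : Type) (s : seq I) (Q : pred I)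
    (F : I -> T -> R) :
  (forall i, bounded_measurable (F i)) ->
  bounded_measurable (fun x => \sum_(i <- s | Q i) F i x).
Proof.
move=> bF; elim: s => [|i s IH].
  by under eq_fun do rewrite big_nil; exact: bounded_measurable_cst.
under eq_fun do rewrite big_cons; case: (Q i) => //.
exact: bounded_measurableD.
Qed.

Lemma bounded_measurable_expR f : bounded_measurable f ->
  bounded_measurable (fun x => expR (f x)).
Proof.
move=> [mf [a fa]]; split; first exact: measurableT_comp.
exists (expR a) => x; rewrite ger0_norm ?expR_ge0// ler_expR.
by rewrite (le_trans _ (fa x))// ler_norm.
Qed.

Variable P : probability T R.

Lemma bounded_measurable_integrable f : bounded_measurable f ->
  P.-integrable setT (EFin \o f).
Proof.
move=> [mf [c fc]]; apply: measurable_bounded_integrable => //.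
  exact: (le_lt_trans (probability_le1 P measurableT) (ltry _)).
by exists c; split; [exact: num_real|move=> M cM x _; exact: le_trans (fc x) (ltW cM)].
Qed.
#[local] Hint Resolve bounded_measurable_integrable : core.

Lemma EFin_mean f : bounded_measurable f ->
  (\int[P]_x f x)%:E = (\int[P]_x (f x)%:E)%E.
Proof.
by move=> bf; rewrite fineK//; apply: integrable_fin_num => //; exact: bounded_measurable_integrable.
Qed.

Lemma mean_cst (c : R) : \int[P]_x c = c.
Proof. by rewrite Rintegral_cst// [X in fine X]probability_setT mulr1. Qed.

Lemma meanD f g : bounded_measurable f -> bounded_measurable g ->
  \int[P]_x (f x + g x) = \int[P]_x f x + \int[P]_x g x.
Proof. by move=> bf bg; rewrite RintegralD//; auto. Qed.

Lemma meanZ (c : R) f : bounded_measurable f ->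
  \int[P]_x (c * f x) = c * \int[P]_x f x.
Proof. by move=> bf; rewrite RintegralZl//; auto. Qed.

Lemma meanN f : bounded_measurable f ->
  \int[P]_x (- f x) = - \int[P]_x f x.
Proof.
move=> bf; rewrite -mulN1r -meanZ//.
by congr (Rintegral _ _ _); apply/funext => x; rewrite mulN1r.
Qed.

Lemma mean_sum (I : Type) (s : seq I) (Q : pred I) (F : I -> T -> R) :
  (forall i, bounded_measurable (F i)) ->
  \int[P]_x (\sum_(i <- s | Q i) F i x) = \sum_(i <- s | Q i) \int[P]_x F i x.
Proof.
move=> bF; elim: s => [|i s IH].
  by under eq_fun do rewrite big_nil; rewrite big_nil mean_cst.
under eq_fun do rewrite big_cons; rewrite big_cons; case: (Q i) => //.
by rewrite meanD// ?IH//; exact: bounded_measurable_sum.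
Qed.

Lemma le_mean f g : bounded_measurable f -> bounded_measurable g ->
  (forall x, f x <= g x) -> \int[P]_x f x <= \int[P]_x g x.
Proof. by move=> bf bg fg; apply: le_Rintegral => //; auto. Qed.

Lemma mean_ge0 f : (forall x, 0 <= f x) -> 0 <= \int[P]_x f x.
Proof. by move=> f0; apply: Rintegral_ge0. Qed.

Lemma mean_norm_le f (c : R) : measurable_fun setT f ->
  (forall x, `|f x| <= c) -> `|\int[P]_x f x| <= c.
Proof.
move=> mf fc; have bf : bounded_measurable f by split => //; exists c.
rewrite ler_norml -[X in _ <= _ <= X]mean_cst -[X in X <= _](mean_cst (- c)).
apply/andP; split; apply: le_mean => //; try exact: bounded_measurable_cst.
- by move=> x; have := fc x; rewrite ler_norml => /andP[].
- by move=> x; have := fc x; rewrite ler_norml => /andP[].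
Qed.

End BoundedMeasurable.

(** From [1 - x <= expR (- x)] follows [expR x <= (1 - x)^-1], and [(1 + x + 2 * x ^+ 2) * (1 - x) =
    1 + x ^+ 2 * (1 - 2 * x)] is at least 1 up to [x = 2^-1]. *)
Lemma expR_le_quadratic {R : realType} (x : R) : x <= 2^-1 ->
  expR x <= 1 + x + 2 * x ^+ 2.
Proof.
move=> x2; have x1 : 0 < 1 - x by lra.
apply: (@le_trans _ _ (1 - x)^-1).
  rewrite -[expR x]invrK lef_pV2 ?posrE ?invr_gt0 ?expR_gt0//.
  by rewrite -expRN; exact: expR_ge1Dx.
rewrite -(ler_pM2r x1) mulVf ?gt_eqF//.
have := sqr_ge0 x; nra.
Qed.

Section Independence.
Context {R : realType} {dO d : measure_display} {Omega : measurableType dO}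
  {U : measurableType d}.
Variables (Pr : probability Omega R) (P : probability U R) (n : nat).
Variable Z : 'I_n -> {RV Pr >-> U}.

(** Independence is assumed for events only. When the function being freed is an indicator, the
    induction hypothesis says that the other factors, taken as a density, are carried by one
    coordinate to a multiple of [P]; [ge0_integral_weighted_pushforward] then integrates an
    arbitrary function at that coordinate. *)
Lemma iid_mean_prod (phi : 'I_n -> U -> R) : iid_sample P Z ->
  (forall i, bounded_measurable (phi i)) -> (forall i u, 0 <= phi i u) ->
  (\int[Pr]_w (\prod_(i < n) phi i (Z i w))%:E =
   (\prod_(i < n) \int[P]_u phi i u)%:E)%E.
Proof.
move=> [indep same].
have mZ i : measurable_fun setT (Z i) by exact: measurable_funPT.
(* The functions are freed from being indicators one at a time. *)
suff claim k : forall phi, (forall i, bounded_measurable (phi i)) ->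
    (forall i u, 0 <= phi i u) ->
    (forall i : 'I_n, (k <= i)%N ->
       exists2 B, measurable B & phi i = \1_B) ->
    (\int[Pr]_w (\prod_(i < n) phi i (Z i w))%:E =
     (\prod_(i < n) \int[P]_u phi i u)%:E)%E.
  by move=> bphi phi0; apply: (claim n) => // i; rewrite leqNgt ltn_ord.
elim: k => [|k IH] {}phi bphi phi0 indphi.
  have /choice[B /all_and2[mB phiB]] : forall i, exists B, measurable B /\ phi i = \1_B.
    by move=> i; have [B mB ->] := indphi i (leq0n i); exists B.
  rewrite (eq_integral (fun w =>
      (\1_(\bigcap_(i in [set: 'I_n]) (Z i @^-1` B i)) w)%:E)); last first.
    move=> w _; congr EFin; rewrite indicE.
    have [win|wout] := boolP (w \in _).
      rewrite big1// => i _; rewrite phiB indicE mem_set//.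
      by move: win; rewrite inE => /(_ i I).
    move: wout; rewrite notin_setE => /existsNP[i /not_implyP[_ Hi]].
    rewrite (bigD1 i)//= phiB indicE memNset// mul0r//.
  rewrite integral_indic//; last first.
    apply: fin_bigcap_measurable => // i _.
    by rewrite -[X in measurable X]setTI; apply: mZ.
  rewrite setIT [LHS]indep// -prodEFin; apply: eq_bigr => i _.
  rewrite EFin_mean// phiB integral_indic// setIT; exact: (same i _ (mB i)).
(* For [n <= k] no index is constrained any more, so the claims at [k] and [k.+1] agree. *)
case: (ltnP k n) => [kn|nk]; last first.
  apply: IH => // i ki; exfalso; have := leq_ltn_trans (leq_trans nk ki) (ltn_ord i).
  by rewrite ltnn.
pose o := Ordinal kn.
have c0 : 0 <= \prod_(i < n | i != o) \int[P]_u phi i u.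
  by apply: prodr_ge0 => i _; exact: mean_ge0.
have bY : measurable_fun setT (fun w => \prod_(i < n | i != o) phi i (Z i w)).
  under eq_fun do rewrite big_mkcond.
  apply: measurable_prod => i _; case: (i != o) => //.
  exact: measurableT_comp (bphi i).1 (mZ i).
rewrite (eq_integral (fun w =>
    ((\prod_(i < n | i != o) phi i (Z i w)) * phi o (Z o w))%:E)); last first.
  by move=> w _; rewrite (bigD1 o)//= mulrC.
(* The multiple of [P] is the product of the other means. *)
rewrite (ge0_integral_weighted_pushforward (nu := mscale (NngNum c0) P))//.
- rewrite ge0_integral_mscale//; last 2 first.
  + exact/measurable_EFinP/(bphi o).1.
  + by move=> u _; rewrite lee_fin.
  by rewrite -EFin_mean// -EFinM [in RHS](bigD1 o)//= mulrC.
- by move=> w; apply: prodr_ge0.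
- move=> B mB; pose phi' i := if i == o then \1_B else phi i.
  have bphi' i : bounded_measurable (phi' i).
    rewrite /phi'; case: ifP => // _; split; first exact: measurable_indic.
    by exists 1 => u; rewrite ger0_norm ?indic_ge0// indic_le1.
  have := IH phi' bphi'; rewrite (bigD1 o)//=.
  rewrite [in X in _ * X](eq_bigr (fun i => \int[P]_u phi i u)); last first.
    by move=> i /negPf io; rewrite /phi' io.
  rewrite /phi' eqxx EFinM EFin_mean; last by have := bphi' o; rewrite /phi' eqxx.
  rewrite integral_indic// setIT /mscale/= muleC => <-.
  + rewrite integral_mkcond; apply: eq_integral => w _.
    rewrite (bigD1 o)//= eqxx [in RHS](eq_bigr (fun i => phi i (Z i w))); last first.
      by move=> i /negPf io; rewrite io.
    by rewrite epatch_indic/= mulrC EFinM.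
  + by move=> i u; case: ifP.
  + move=> i ki; case: (eqVneq i o) => [_|io]; first by exists B.
    by apply: indphi; rewrite ltn_neqAle ki andbT eq_sym.
- exact: (bphi o).1.
Qed.

End Independence.

(** * Events of prescribed probability and the union bound *)

Section WithProbability.
Context {R : realType} {d : measure_display} {Omega : measurableType d}.
Variable Pr : probability Omega R.

Lemma with_probability_ge_le (p q : R) (Q Q' : Omega -> Prop) :
  q <= p -> (forall w, Q w -> Q' w) ->
  with_probability_ge Pr p Q -> with_probability_ge Pr q Q'.
Proof.
move=> qp QQ' [E [mE pE EQ]]; exists E; split=> // [|w /EQ/QQ']//.
by rewrite (le_trans _ pE)// lee_fin.
Qed.

(** Stated through the failure probabilities [p] and [q], which add up:
    [Pr (F]\[E) <= 1 - Pr E <= p] is all that [F] loses by intersection with [E]. *)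
Lemma with_probability_ge_and (p q : R) (Q Q' : Omega -> Prop) :
  with_probability_ge Pr (1 - p) Q -> with_probability_ge Pr (1 - q) Q' ->
  with_probability_ge Pr (1 - (p + q)) (fun w => Q w /\ Q' w).
Proof.
move=> [E [mE pE EQ]] [F [mF qF FQ]]; exists (E `&` F); split.
- exact: measurableI.
- have PrE A : measurable A -> Pr A = (fine (Pr A))%:E.
    by move=> mA; rewrite fineK// fin_num_measure.
  have mD : measurable (F `\` E) by exact: measurableD.
  have mI : measurable (F `&` E) by exact: measurableI.
  have H1 : (Pr (F `\` E) + Pr E <= 1)%E.
    rewrite -measureU//.
      by apply: probability_le1; exact: measurableU.
    by rewrite setDE -setIA setICl setI0.
  have H2 : Pr F = (Pr (F `\` E) + Pr (F `&` E))%E.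
    by rewrite -measureDI.
  move: pE qF H1; rewrite H2 (setIC E F) (PrE _ mE) (PrE _ mD) (PrE _ mI).
  by rewrite -!EFinD !lee_fin; lra.
- by move=> w [/EQ ? /FQ ?].
Qed.

Lemma with_probability_ge_all (I : eqType) (s : seq I) (p : R)
    (Q : I -> Omega -> Prop) :
  (forall i, i \in s -> with_probability_ge Pr (1 - p) (Q i)) ->
  with_probability_ge Pr (1 - (size s)%:R * p)
    (fun w => forall i, i \in s -> Q i w).
Proof.
elim: s => [|i s IH] H.
  exists setT; split => //; rewrite mul0r subr0 [X in (_ <= X)%E]probability_setT//.
apply: with_probability_ge_le (with_probability_ge_and (H i (mem_head i s)) (IH _)).
- by rewrite /= -natr1 mulrDl mul1r; lra.
- by move=> w [Qi Qs] j; rewrite inE => /predU1P[->//|/Qs].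
- by move=> j js; apply: H; rewrite inE js orbT.
Qed.

End WithProbability.

Section Chernoff.
Context {R : realType} {dO d : measure_display} {Omega : measurableType dO}
  {U : measurableType d}.
Variables (Pr : probability Omega R) (P : probability U R) (n : nat).
Variable Z : 'I_n -> {RV Pr >-> U}.
Hypothesis iidZ : iid_sample P Z.

(** Integrating [expR_le_quadratic] at [s * Y] gives at most [1 + s * m + 2 * s ^+ 2 * v], hence at
    most the exponential of [s * m + 2 * s ^+ 2 * v]; centering removes [s * m]. *)
Lemma mean_expR_centered (Y : U -> R) (s v : R) : bounded_measurable Y ->
  (forall x, s * Y x <= 2^-1) -> \int[P]_x (Y x ^+ 2) <= v ->
  \int[P]_x expR (s * (Y x - \int[P]_y Y y)) <= expR (2 * s ^+ 2 * v).
Proof.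
move=> bY sY vY; set m := Rintegral P setT Y.
have bY2 : bounded_measurable (fun x => Y x ^+ 2) by exact: bounded_measurableM.
have bsY := bounded_measurableZ s bY.
have b2 : bounded_measurable (fun x => 2 * s ^+ 2 * Y x ^+ 2) by exact: bounded_measurableZ.
have b1 : bounded_measurable (fun x => 1 + s * Y x).
  by apply: bounded_measurableD => //; exact: bounded_measurable_cst.
have be := bounded_measurable_expR bsY.
have -> : \int[P]_x expR (s * (Y x - m)) = expR (- (s * m)) * \int[P]_x expR (s * Y x).
  rewrite -meanZ//; apply: eq_Rintegral => x _.
  by rewrite -expRD; congr expR; ring.
rewrite expRN mulrC ler_pdivrMr ?expR_gt0// -expRD.
apply: (@le_trans _ _ (\int[P]_x (1 + s * Y x + 2 * s ^+ 2 * Y x ^+ 2))).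
  apply: le_mean => //; first exact: bounded_measurableD.
  by move=> x; rewrite (le_trans (expR_le_quadratic (sY x)))// exprMn mulrA.
rewrite meanD// meanD//; last exact: bounded_measurable_cst.
rewrite mean_cst !meanZ//.
apply: le_trans (expR_ge1Dx _); rewrite -/m.
have : 2 * s ^+ 2 * \int[P]_x (Y x ^+ 2) <= 2 * s ^+ 2 * v.
  by rewrite ler_wpM2l// mulr_ge0// sqr_ge0.
lra.
Qed.

(** Markov's inequality for the exponential of [s] times the centered sum, whose mean factorizes by
    [iid_mean_prod]. *)
Lemma chernoff_iid (Y : U -> R) (s v u : R) : bounded_measurable Y ->
  (forall x, s * Y x <= 2^-1) -> \int[P]_x (Y x ^+ 2) <= v -> 0 <= s ->
  (Pr [set w | (n%:R * u <= \sum_(i < n) (Y (Z i w) - \int[P]_y Y y))%R] <=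
   (expR (n%:R * (2 * s ^+ 2 * v - s * u)))%:E)%E.
Proof.
move=> bY sY vY s0; set m := Rintegral P setT Y.
set A := [set w | _].
have mZ i : measurable_fun setT (Z i) by exact: measurable_funPT.
have mS : measurable_fun setT (fun w => \sum_(i < n) (Y (Z i w) - m)).
  apply: measurable_sum => i; apply: measurable_funB => //.
  exact: measurableT_comp bY.1 (mZ i).
have mA : measurable A.
  rewrite -[A]setTI; apply: measurable_fun_ler => //; exact: measurable_cst.
pose phi := fun x => expR (s * (Y x - m)).
have bphi : bounded_measurable phi.
  apply: bounded_measurable_expR; apply: bounded_measurableZ.
  by apply: bounded_measurableB => //; exact: bounded_measurable_cst.
have prodE w : \prod_(i < n) phi (Z i w) = expR (s * \sum_(i < n) (Y (Z i w) - m)).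
  by rewrite -expR_sum -mulr_sumr.
have mprod : measurable_fun setT (fun w => \prod_(i < n) phi (Z i w)).
  apply: measurable_prod => i _; exact: measurableT_comp bphi.1 (mZ i).
apply: (@le_trans _ _ (expR (- (s * (n%:R * u))) *
    \prod_(i < n) \int[P]_x phi x)%:E); last first.
  rewrite lee_fin mulrBr expRD mulrC ler_pM ?expR_ge0//.
  - by apply: prodr_ge0 => i _; apply: mean_ge0 => x; exact: expR_ge0.
  - rewrite prodr_const card_ord expRM_natl.
    rewrite lerXn2r ?nnegrE ?expR_ge0//.
      by apply: mean_ge0 => x; exact: expR_ge0.
    by rewrite mean_expR_centered.
  - by rewrite ler_expR mulrCA.
have -> : Pr A = (\int[Pr]_w (\1_A w)%:E)%E by rewrite integral_indic// setIT.
rewrite EFinM -(iid_mean_prod iidZ (fun=> bphi)); last by move=> i x; exact: expR_ge0.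
rewrite -ge0_integralZl_EFin ?expR_ge0//; last 2 first.
- by move=> w _; rewrite lee_fin; apply: prodr_ge0 => i _; exact: expR_ge0.
- exact/measurable_EFinP.
apply: ge0_le_integral => //.
- exact/measurable_EFinP/measurable_indic.
- by apply/measurable_EFinP; apply: measurable_funM => //; exact: measurable_cst.
- move=> w _; rewrite -EFinM lee_fin indicE.
  have [wA|wA] := boolP (w \in A); last first.
    by rewrite mulr_ge0 ?expR_ge0//; apply: prodr_ge0 => i _; exact: expR_ge0.
  rewrite prodE -expRD -[leLHS]expR0 ler_expR addrC subr_ge0 ler_wpM2l//.
  by move: wA; rewrite inE.
Qed.

(** The empirical process [(P_n - P) Y]. The sample [z] is a fixed tuple, so that linearity is a
    deterministic fact. *)
Definition deviation (z : 'I_n -> U) (Y : U -> R) :=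
  n%:R^-1 * \sum_(i < n) Y (z i) - \int[P]_x Y x.

(** The one-sided bound is applied to [Y] and to [- Y], whence the factor 2. The parameter [s] stays
    free: it is taken proportional to the radius for single atoms and constant for net points. *)
Lemma deviation_bound (Y : U -> R) (s v u : R) : (0 < n)%N ->
  bounded_measurable Y ->
  (forall x, s * `|Y x| <= 2^-1) -> \int[P]_x (Y x ^+ 2) <= v -> 0 <= s ->
  with_probability_ge Pr (1 - 2 * expR (n%:R * (2 * s ^+ 2 * v - s * u)))
    (fun w => `|deviation (fun i => Z i w) Y| <= u).
Proof.
move=> n0 bY sY vY s0.
have n0' : 0 < n%:R :> R by rewrite ltr0n.
pose S Y w : R := \sum_(i < n) (Y (Z i w) - \int[P]_y Y y).
have one_sided Y' : bounded_measurable Y' ->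
    (forall x, s * Y' x <= 2^-1) -> \int[P]_x (Y' x ^+ 2) <= v ->
    with_probability_ge Pr (1 - expR (n%:R * (2 * s ^+ 2 * v - s * u)))
    (fun w => deviation (fun i => Z i w) Y' <= u).
  move=> bY' sY' vY'.
  have mA : measurable [set w | n%:R * u <= S Y' w].
    rewrite -[X in measurable X]setTI; apply: measurable_fun_ler => //.
    apply: measurable_sum => i; apply: measurable_funB => //.
    by apply: measurableT_comp bY'.1 _; exact: measurable_funPT.
  exists (~` [set w | n%:R * u <= S Y' w]); split.
  - exact: measurableC.
  - have := chernoff_iid u bY' sY' vY' s0; rewrite -/(S Y').
    rewrite [X in _ -> (_ <= X)%E]probability_setC//.
    have -> : Pr [set w | n%:R * u <= S Y' w] = (fine (Pr [set w | n%:R * u <= S Y' w]))%:E.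
      by rewrite fineK// fin_num_measure.
    by rewrite -EFinB !lee_fin => ?; lra.
  - move=> w /= /negP; rewrite -ltNge => /ltW.
    rewrite /S sumrB sumr_const card_ord -[X in _ - X]mulr_natl => H.
    rewrite /deviation -(ler_pM2l n0') mulrBr mulrA divff ?gt_eqF// mul1r//.
apply: with_probability_ge_le (with_probability_ge_and (one_sided Y bY _ vY)
    (one_sided (fun x => - Y x) (bounded_measurableN bY) _ _)).
- lra.
- move=> w [H1]; rewrite /deviation meanN// sumrN mulrN => H2.
  by rewrite ler_norml H1 andbT; rewrite /deviation; lra.
- by move=> x; rewrite (le_trans _ (sY x))// ler_wpM2l// ler_norm.
- by move=> x; rewrite (le_trans _ (sY x))// ler_wpM2l// -normrN ler_norm.
- by under eq_fun do rewrite sqrrN.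
Qed.

End Chernoff.

(** * Nets in finite-dimensional normed spaces *)

(** An element is kept only if it is close to none of those already kept, which gives separation; a
    rejected element is covered by the one that rejected it. *)
Lemma greedy_separated (T : eqType) (close : rel T) (s : seq T) :
  symmetric close -> reflexive close ->
  exists t : seq T, [/\ uniq t, {subset t <= s},
    {in t &, forall x y, close x y -> x = y} &
    forall x, x \in s -> exists2 y, y \in t & close x y].
Proof.
move=> sym refl; elim: s => [|x s [t [ut ts sep cov]]]; first by exists [::].
have [/hasP[y yt xy]|/hasPn far] := boolP (has (close x) t).
  exists t; split=> //; first by move=> z /ts zs; rewrite inE zs orbT.
  by move=> z; rewrite inE => /predU1P[->|/cov//]; exists y.
exists (x :: t); split.
- rewrite /= ut andbT; apply/negP => /far; rewrite refl//.
- by move=> z; rewrite !inE => /predU1P[->|/ts ->]; rewrite ?eqxx ?orbT.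
- move=> y z; rewrite !inE => /predU1P[->|yt] /predU1P[->|zt]//.
  + by move=> xz; have := far _ zt; rewrite xz.
  + by rewrite sym => xy; have := far _ yt; rewrite xy.
  + exact: sep.
- move=> z; rewrite inE => /predU1P[->|/cov[y yt zy]].
    by exists x; rewrite ?mem_head ?refl.
  by exists y => //; rewrite inE yt orbT.
Qed.

Section Net.
Context {R : realType} {d : nat}.
Variables (p : 'rV[R]_d -> R) (cl cu : R).
Hypothesis pD : forall x y, p (x + y) <= p x + p y.
Hypothesis pZ : forall a x, p (a *: x) = `|a| * p x.
Hypothesis cl_gt0 : 0 < cl.
Hypothesis p_lower : forall (x : 'rV[R]_d) j, cl * `|x ord0 j| <= p x.
Hypothesis cu_gt0 : 0 < cu.
Hypothesis p_upper : forall x : 'rV[R]_d, p x <= cu * \sum_j `|x ord0 j|.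

(** The mesh is such that [cu * d.+1%:R * eta = 4^-1], the allowed rounding error; [d.+1] keeps it
    positive and finite in dimension 0. *)
Let eta : R := (4 * cu * d.+1%:R)^-1.
Let lat (z : 'rV[int]_d) : 'rV[R]_d := eta *: map_mx intr z.

Let eta_gt0 : 0 < eta.
Proof. by rewrite invr_gt0 !mulr_gt0. Qed.

Let latD y z : lat (y + z) = lat y + lat z.
Proof. by rewrite /lat map_mxD scalerDr. Qed.

Let latN z : lat (- z) = - lat z.
Proof. by rewrite /lat map_mxN scalerN. Qed.

Let latMn z n : lat (z *+ n) = n%:R *: lat z.
Proof.
elim: n => [|n IH]; first by rewrite mulr0n scale0r /lat map_mx0 scaler0.
by rewrite mulrSr latD IH -natr1 scalerDl scale1r.
Qed.

Let pN x : p (- x) = p x.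
Proof. by rewrite -scaleN1r pZ normrN1 mul1r. Qed.

Let p0 : p 0 = 0.
Proof. by rewrite -(scale0r (0 : 'rV[R]_d)) pZ normr0 mul0r. Qed.

Let pB x y : p (x - y) <= p x + p y.
Proof. by rewrite (le_trans (pD _ _))// pN. Qed.

Lemma round_lattice (x : 'rV[R]_d) : exists z, p (x - lat z) <= 4^-1.
Proof.
exists (\row_j Num.floor (x ord0 j / eta)).
apply: (le_trans (p_upper _)).
apply: (@le_trans _ _ (cu * (d.+1%:R * eta))); last first.
  have D0 : d.+1%:R != 0 :> R by rewrite pnatr_eq0.
  have u0 : cu != 0 by rewrite gt_eqF.
  move: D0; rewrite /eta; move: (d.+1%:R : R) => D D0.
  by rewrite le_eqVlt; apply/orP; left; apply/eqP; field; rewrite u0 D0.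
rewrite ler_pM2l//.
apply: (@le_trans _ _ (\sum_(j < d) eta)); last first.
  by rewrite sumr_const card_ord -[X in X <= _]mulr_natl ler_pM2r// ler_nat.
apply: ler_sum => j _; rewrite !mxE.
have /andP[h1 h2] := mem_rg1_floor (x ord0 j / eta).
rewrite ler_norml.
move: h1 h2; rewrite ler_pdivlMr// ltr_pdivrMr// mulrDl mul1r => h1 h2.
apply/andP; split; lra.
Qed.

Let rho_box : exists B : nat, forall z : 'rV[int]_d, p (lat z) <= 2 ->
  forall j, (`|z ord0 j| <= B)%N.
Proof.
exists (Num.truncn (2 / (cl * eta))).+1 => z pz j.
have := le_trans (p_lower (lat z) j) pz.
rewrite /lat !mxE normrM (gtr0_norm eta_gt0) mulrA -ler_pdivlMl ?mulr_gt0//.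
rewrite mulrC -intr_norm -abszE => H.
rewrite -(ler_nat R); apply/ltW/(le_lt_trans H).
by rewrite truncnS_gt.
Qed.

Let enum_ball : exists2 s : seq 'rV[int]_d, uniq s &
  forall z, (p (lat z) <= 2 -> z \in s).
Proof.
have [B HB] := rho_box.
(* Coordinates between [- B] and [B] are shifted by [B] to become ordinals. *)
exists (undup [seq \row_j ((f j : nat)%:Z - B%:Z) |
  f : {ffun 'I_d -> 'I_(B + B).+1} <- enum {: {ffun 'I_d -> 'I_(B + B).+1}}]).
  exact: undup_uniq.
move=> z /HB zB; rewrite mem_undup; apply/mapP.
exists [ffun j => inord `|(z ord0 j + B%:Z)%R|%N]; first by rewrite mem_enum.
apply/rowP => j; rewrite !mxE ffunE.
have := zB j => zj.
by rewrite inordK -[z 0 j]/(z ord0 j); lia.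
Qed.

(** The usual volume comparison, carried out by counting lattice points. The net is a maximal
    [4^-1]-separated set [t] in the lattice ball of radius 5/4; the translates of [small] by [t] are
    disjoint and lie in [large], which has at most [22 ^ d] times as many points as [small]. The
    constants [cl] and [cu] affect only the lattice, not this ratio. *)
Lemma exists_half_net : exists s : seq 'rV[R]_d,
  [/\ (size s <= 22 ^ d)%N, forall v, v \in s -> p v <= 2 &
      forall x, p x <= 1 -> exists2 v, v \in s & p (x - v) <= 2^-1].
Proof.
have [s us sP] := enum_ball.
pose ball (rho : R) := [seq z <- s | p (lat z) <= rho].
have mem_ball rho z : rho <= 2 -> (z \in ball rho) = (p (lat z) <= rho).
  move=> rho2; rewrite mem_filter andb_idr// => pz.
  by apply: sP; exact: le_trans rho2.
pose close y z := p (lat (y - z)) <= 4^-1.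
have close_sym : symmetric close.
  by move=> y z; rewrite /close -opprB latN pN.
have close_refl : reflexive close.
  move=> y; rewrite /close subrr /lat map_mx0 scaler0 p0; lra.
(* Rounding a point of the unit ball gives a lattice point of radius at most [1 + 1/4]; rounding and
   covering errors add up to [1/4 + 1/4]. *)
have [t [ut ts sep cov]] := greedy_separated (ball (5 / 4)) close_sym close_refl.
(* Two points of [small] differ by at most the separation [1/4], and [5/4 + 1/8 = 11/8]. *)
pose small := ball 8^-1; pose large := ball (11 / 8).
(* The modulus is 22 because two points of [large] are at distance at most [22/8], so that dividing
   their difference by 22 lands in [small]. *)
pose residue (z : 'rV[int]_d) : {ffun 'I_d -> 'I_22} :=
  [ffun j => inord `|(z ord0 j %% 22)%Z|%N].
(* The default 0 of [head] is never taken at the residue of a point of [large]. *)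
pose rep c := head 0 [seq z <- large | residue z == c].
pose quot (z : 'rV[int]_d) : 'rV[int]_d :=
  \row_j ((z ord0 j - rep (residue z) ord0 j) %/ 22)%Z.
have rep_spec z : z \in large ->
    rep (residue z) \in large /\ residue (rep (residue z)) = residue z.
  move=> zl; suff : rep (residue z) \in [seq y <- large | residue y == residue z].
    by rewrite mem_filter => /andP[/eqP ? ?].
  rewrite /rep; have : z \in [seq y <- large | residue y == residue z].
    by rewrite mem_filter eqxx.
  by case: [seq y <- _ | _] => // y l _; rewrite mem_head.
have quotE z : z \in large -> z = rep (residue z) + quot z *+ 22.
  move=> zl; have [_ /ffunP eqr] := rep_spec z zl.
  apply/rowP => j; have := eqr j; rewrite !ffunE => /(congr1 val) /= E.
  rewrite [RHS]mxE mulmxnE [X in _ + X *+ _]mxE.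
  move: E; rewrite -[z 0 j]/(z ord0 j) -[rep _ 0 j]/(rep (residue z) ord0 j).
  move: (z ord0 j) (rep _ ord0 j) => a b.
  rewrite !inordK; lia.
have quot_small z : z \in large -> quot z \in small.
  move=> zl; have [rl _] := rep_spec z zl.
  move: (zl) (rl); rewrite !mem_ball; [|lra..] => pz pr.
  have -> : lat (quot z) = 22^-1 *: (lat z - lat (rep (residue z))).
    rewrite {2}(quotE z zl) latD addrAC subrr add0r latMn scalerA mulVf ?scale1r//.
  rewrite pZ gtr0_norm ?invr_gt0//.
  by have := pB (lat z) (lat (rep (residue z))); lra.
have sum_large y z : y \in t -> z \in small -> y + z \in large.
  move=> /ts; rewrite !mem_ball; [|lra..] => py pz.
  by rewrite latD; have := pD (lat y) (lat z); lra.
(* The pair (residue, quotient) determines [y + z], and separation of [t] then determines [y] and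
   [z]. *)
have size_t : (size t * size small <= 22 ^ d * size small)%N.
  pose target := [seq (c, z) | c <- enum {: {ffun 'I_d -> 'I_22}}, z <- small].
  rewrite -[leqLHS](size_allpairs (fun y z => (residue (y + z), quot (y + z)))).
  have -> : (22 ^ d * size small)%N = size target.
    by rewrite size_allpairs -cardE card_ffun !card_ord.
  apply: uniq_leq_size.
    apply: allpairs_uniq => //; first exact: filter_uniq.
    move=> u v /allpairsP[[y z] /= [yt zs ->]].
    move=> /allpairsP[[y' z'] /= [yt' zs' ->]] [eqr eqq].
    have E : y + z = y' + z'.
      by rewrite (quotE _ (sum_large _ _ yt zs)) (quotE _ (sum_large _ _ yt' zs')) eqr eqq.
    have yy : y = y'.
      apply: sep => //; rewrite /close.
      have -> : y - y' = z' - z.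
        by apply/eqP; rewrite subr_eq -{1}[y](addrK z) E [y' + z']addrC addrAC.
      rewrite latD latN; move: zs zs'; rewrite !mem_ball; [|lra..] => pz pz'.
      by have := pB (lat z') (lat z); lra.
    by move: E; rewrite yy => /addrI ->.
  move=> _ /allpairsP[[y z] /= [yt zs ->]].
  apply/allpairsP; exists (residue (y + z), quot (y + z)); split => //=.
    by rewrite mem_enum.
  exact: quot_small (sum_large _ _ yt zs).
exists [seq lat z | z <- t]; split.
(* The factor [size small] cancels since [small] contains 0. *)
- rewrite size_map; move: size_t; rewrite leq_pmul2r//.
  rewrite -has_predT; apply/hasP; exists 0 => //.
  rewrite mem_ball; last lra.
  by rewrite /lat map_mx0 scaler0 p0; lra.
- move=> _ /mapP[z /ts zb ->]; move: zb; rewrite mem_ball; lra.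
- move=> x px; have [z xz] := round_lattice x.
  have zb : z \in ball (5 / 4).
    rewrite mem_ball; last lra.
    by have := pB x (x - lat z); rewrite subKr; lra.
  have [y yt zy] := cov z zb; exists (lat y); first by apply/mapP; exists y.
  rewrite -(subrKA (lat z)); move: zy; rewrite /close latD latN.
  by have := pD (x - lat z) (lat z - lat y); lra.
Qed.

End Net.

Lemma row_linear_expand {R : realType} {d : nat} (X : 'rV[R]_d -> R) :
  (forall x y, X (x + y) = X x + X y) -> (forall a x, X (a *: x) = a * X x) ->
  forall x, X x = \sum_j x ord0 j * X (delta_mx ord0 j).
Proof.
move=> XD XZ x; rewrite {1}(row_sum_delta x).
have X0 : X 0 = 0 by rewrite -(scale0r (0 : 'rV[R]_d)) XZ mul0r.
by rewrite (big_morph X XD X0); apply: eq_bigr => j _; rewrite XZ.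
Qed.

(** Writing [x = v + (x - v)] with [2 *: (x - v)] again in the unit ball gives [sup <= M + sup / 2].
    To avoid assuming the supremum finite, a crude bound is halved [k] times. *)
Lemma half_net_bound {R : realType} {d : nat} (p : 'rV[R]_d -> R) (cl : R)
    (s : seq 'rV[R]_d) (X : 'rV[R]_d -> R) (M : R) :
  (forall a x, p (a *: x) = `|a| * p x) ->
  0 < cl -> (forall (x : 'rV[R]_d) j, cl * `|x ord0 j| <= p x) ->
  (forall x, p x <= 1 -> exists2 v, v \in s & p (x - v) <= 2^-1) ->
  (forall x y, X (x + y) = X x + X y) -> (forall a x, X (a *: x) = a * X x) ->
  (forall v, v \in s -> `|X v| <= M) ->
  forall x, p x <= 1 -> `|X x| <= 2 * M.
Proof.
move=> pZ cl0 pl net XD XZ XM.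
(* The crude bound: coordinates of points of the unit ball are at most [cl^-1] in absolute value. *)
pose B := \sum_j cl^-1 * `|X (delta_mx ord0 j)|.
have halving k : forall x, p x <= 1 -> `|X x| <= 2 * M + B / 2 ^+ k.
  elim: k => [|k IH] x px.
    have M0 : 0 <= M.
      by have [v /XM vM _] := net x px; apply: le_trans vM.
    rewrite expr0 divr1 (row_linear_expand XD XZ) (le_trans (ler_norm_sum _ _ _))//.
    apply: ler_wpDl; first by rewrite mulr_ge0.
    apply: ler_sum => j _; rewrite normrM ler_wpM2r//.
    by rewrite -[cl^-1]mulr1 ler_pdivlMl// (le_trans (pl _ _)).
  have [v vs pxv] := net x px.
  have /IH : p (2 *: (x - v)) <= 1 by rewrite pZ gtr0_norm//; lra.
  rewrite XZ normrM gtr0_norm// => H; have Hv := XM v vs.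
  have -> : x = v + (x - v) by rewrite addrC subrK.
  rewrite XD (le_trans (ler_normD _ _))//.
  have -> : B / 2 ^+ k.+1 = (B / 2 ^+ k) / 2 by rewrite exprSr invfM mulrA.
  lra.
move=> x px; apply/ler_addgt0Pr => e e0.
(* Then [B / e < k.+1 < 2 ^ k.+1]. *)
pose k := Num.truncn (B / e).
apply: (le_trans (halving k.+1 x px)); rewrite lerD2l.
rewrite ler_pdivrMr ?exprn_gt0// mulrC -ler_pdivrMr//.
apply/ltW/(lt_le_trans (truncnS_gt _)).
by rewrite -natrX ler_nat ltnW// ltn_expl.
Qed.

(** * Uniform deviations over the dictionary *)

Section L2.
Context {R : realType} {d : measure_display} {T : measurableType d}.
Variable P : probability T R.
Implicit Types f g : T -> R.

Definition l2norm f : R := Num.sqrt (\int[P]_x (f x ^+ 2)).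

Lemma bounded_measurable_sqr f : bounded_measurable f ->
  bounded_measurable (fun x => f x ^+ 2).
Proof. by move=> bf; apply: bounded_measurableM. Qed.

Lemma l2norm_ge0 f : 0 <= l2norm f. Proof. exact: sqrtr_ge0. Qed.

Lemma l2norm_sqr f : l2norm f ^+ 2 = \int[P]_x (f x ^+ 2).
Proof. by rewrite sqr_sqrtr//; apply: mean_ge0 => x; exact: sqr_ge0. Qed.

Lemma l2normZ (a : R) f : bounded_measurable f ->
  l2norm (fun x => a * f x) = `|a| * l2norm f.
Proof.
move=> bf; rewrite /l2norm; under eq_fun do rewrite exprMn.
rewrite meanZ; last exact: bounded_measurable_sqr.
by rewrite sqrtrM ?sqr_ge0// sqrtr_sqr.
Qed.

Lemma l2normN f : l2norm (fun x => - f x) = l2norm f.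
Proof. by rewrite /l2norm; under eq_fun do rewrite sqrrN. Qed.

(** Minkowski's inequality from the pointwise bound [(f + g)^2 <= (a + c) / a * f^2 + (a + c) / c *
    g^2], integrated with [a] and [c] close to the two norms. *)
Lemma ler_l2normD f g : bounded_measurable f -> bounded_measurable g ->
  l2norm (fun x => f x + g x) <= l2norm f + l2norm g.
Proof.
move=> bf bg; apply/ler_addgt0Pr => e e0.
(* The margin [e / 2] makes [a] and [c] positive even when a norm vanishes. *)
pose a := l2norm f + e / 2; pose c := l2norm g + e / 2.
have a0 : 0 < a by rewrite /a; have := l2norm_ge0 f; lra.
have c0 : 0 < c by rewrite /c; have := l2norm_ge0 g; lra.
have -> : l2norm f + l2norm g + e = a + c by rewrite /a /c; lra.
rewrite -[leRHS]ger0_norm; last by rewrite addr_ge0 ?ltW.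
rewrite -sqrtr_sqr ler_wsqrtr//.
have bf2 := bounded_measurable_sqr bf.
have bg2 := bounded_measurable_sqr bg.
have bfa : bounded_measurable (fun x => (a + c) / a * f x ^+ 2) by exact: bounded_measurableZ.
have bgc : bounded_measurable (fun x => (a + c) / c * g x ^+ 2) by exact: bounded_measurableZ.
apply: (@le_trans _ _ (\int[P]_x ((a + c) / a * f x ^+ 2 + (a + c) / c * g x ^+ 2))).
  apply: le_mean.
  - exact/bounded_measurable_sqr/bounded_measurableD.
  - exact: bounded_measurableD.
  - move=> x; rewrite -subr_ge0.
    have -> : (a + c) / a * f x ^+ 2 + (a + c) / c * g x ^+ 2 - (f x + g x) ^+ 2
        = (c * f x - a * g x) ^+ 2 / (a * c).
      by field; rewrite !gt_eqF.
    by rewrite divr_ge0 ?sqr_ge0// mulr_ge0 ?ltW.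
rewrite meanD// !meanZ// -!l2norm_sqr.
have -> : (a + c) ^+ 2 = (a + c) / a * a ^+ 2 + (a + c) / c * c ^+ 2.
  by field; rewrite !gt_eqF.
have ac0 : 0 < a + c by exact: addr_gt0.
apply: lerD; apply: ler_wpM2l; rewrite ?divr_ge0 ?(ltW ac0) ?(ltW a0) ?(ltW c0)//.
- by rewrite lerXn2r ?nnegrE ?l2norm_ge0 ?(ltW a0)// /a; lra.
- by rewrite lerXn2r ?nnegrE ?l2norm_ge0 ?(ltW c0)// /c; lra.
Qed.

Lemma l2norm_le f (c : R) : bounded_measurable f -> 0 <= c ->
  (forall x, `|f x| <= c) -> l2norm f <= c.
Proof.
move=> bf c0 fc; rewrite -[leRHS]ger0_norm// -sqrtr_sqr ler_wsqrtr//.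
rewrite -[leRHS](mean_cst P); apply: le_mean.
- exact: bounded_measurable_sqr.
- exact: bounded_measurable_cst.
- by move=> x; rewrite -[f x ^+ 2]real_normK ?num_real// lerXn2r ?nnegrE.
Qed.

End L2.

Section Dictionary.
Context {R : realType} {dS dT : measure_display}.
Context {S : measurableType dS} {T : measurableType dT}.
Variable P : probability (S * T)%type R.

Definition mixture_pair {N : nat} (h : 'I_N -> S -> R) (w : 'rV[R]_N)
  (z : S * T) : R := mixture h w z.1.

Definition l1norm {N : nat} (w : 'rV[R]_N) : R := \sum_j `|w ord0 j|.

Section Mixtures.
Context {N : nat}.
Variable h : 'I_N -> S -> R.
Hypothesis mh : forall j, measurable_fun setT (h j).
Hypothesis h1 : forall j x, `|h j x| <= 1.

Lemma mixtureD v w x : mixture h (v + w) x = mixture h v x + mixture h w x.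
Proof. by rewrite -big_split; apply: eq_bigr => j _; rewrite mxE mulrDl. Qed.

Lemma mixtureZ a w x : mixture h (a *: w) x = a * mixture h w x.
Proof. by rewrite mulr_sumr; apply: eq_bigr => j _; rewrite mxE mulrA. Qed.

Lemma mixtureB v w x : mixture h (v - w) x = mixture h v x - mixture h w x.
Proof. by rewrite mixtureD -scaleN1r mixtureZ mulN1r. Qed.

Lemma norm_mixture_le w x : `|mixture h w x| <= l1norm w.
Proof.
apply: (le_trans (ler_norm_sum _ _ _)); apply: ler_sum => j _.
by rewrite normrM ler_piMr.
Qed.

Lemma bounded_measurable_atom j : bounded_measurable (fun z : S * T => h j z.1).
Proof. by split; [exact: measurableT_comp|exists 1]. Qed.

Lemma bounded_measurable_mixture w :
  bounded_measurable (mixture_pair h w : S * T -> R).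
Proof.
apply: bounded_measurable_sum => j.
exact/bounded_measurableZ/bounded_measurable_atom.
Qed.

Lemma l1normD (v w : 'rV[R]_N) : l1norm (v + w) <= l1norm v + l1norm w.
Proof.
by rewrite -big_split; apply: ler_sum => j _; rewrite mxE ler_normD.
Qed.

Lemma l1normZ a (w : 'rV[R]_N) : l1norm (a *: w) = `|a| * l1norm w.
Proof. by rewrite mulr_sumr; apply: eq_bigr => j _; rewrite mxE normrM. Qed.

Lemma l1norm_ge0 (w : 'rV[R]_N) : 0 <= l1norm w.
Proof. by apply: sumr_ge0. Qed.

Lemma l2norm_mixtureD v w : l2norm P (mixture_pair h (v + w)) <=
  l2norm P (mixture_pair h v) + l2norm P (mixture_pair h w).
Proof.
have -> : mixture_pair h (v + w) = (fun z : S * T => mixture_pair h v z + mixture_pair h w z).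
  by apply/funext => z; exact: mixtureD.
by apply: ler_l2normD; exact: bounded_measurable_mixture.
Qed.

Lemma l2norm_mixtureZ a w : l2norm P (mixture_pair h (a *: w)) =
  `|a| * l2norm P (mixture_pair h w).
Proof.
rewrite -l2normZ; last exact: bounded_measurable_mixture.
by congr (l2norm P _); apply/funext => z; exact: mixtureZ.
Qed.

Lemma l2norm_mixture_le w : l2norm P (mixture_pair h w) <= l1norm w.
Proof.
apply: l2norm_le => [||z]; first exact: bounded_measurable_mixture.
  exact: l1norm_ge0.
exact: norm_mixture_le.
Qed.

(* The net is taken for the norm whose unit ball is the set of [v] with
   [l1norm v <= 2] and [l2norm v <= r] itself, so that it has at most [22 ^ N]
   points whatever the dictionary, while its points stay uniformly bounded. *)
Lemma mixture_net (r : R) : 0 < r -> exists s : seq 'rV[R]_N,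
  [/\ (size s <= 22 ^ N)%N,
      forall v, v \in s -> l1norm v <= 4 /\ l2norm P (mixture_pair h v) <= 2 * r &
      forall (X : 'rV[R]_N -> R) (M : R),
        (forall x y, X (x + y) = X x + X y) ->
        (forall a x, X (a *: x) = a * X x) ->
        (forall v, v \in s -> `|X v| <= M) ->
        forall v, l1norm v <= 2 -> l2norm P (mixture_pair h v) <= r ->
        `|X v| <= 2 * M].
Proof.
move=> r0.
pose p v := Num.max (l1norm v / 2) (l2norm P (mixture_pair h v) / r).
have pD x y : p (x + y) <= p x + p y.
  rewrite /p ge_max; apply/andP; split.
    apply: (@le_trans _ _ (l1norm x / 2 + l1norm y / 2)).
      by rewrite -mulrDl ler_wpM2r// l1normD.
    by apply: lerD; rewrite le_max lexx.
  apply: (@le_trans _ _ (l2norm P (mixture_pair h x) / r + l2norm P (mixture_pair h y) / r)).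
    by rewrite -mulrDl ler_wpM2r ?invr_ge0 ?(ltW r0)// l2norm_mixtureD.
  by apply: lerD; rewrite le_max lexx orbT.
have pZ a x : p (a *: x) = `|a| * p x.
  by rewrite /p l1normZ l2norm_mixtureZ -!mulrA maxr_pMr.
have pl (x : 'rV[R]_N) j : 2^-1 * `|x ord0 j| <= p x.
  rewrite le_max mulrC ler_wpM2r//.
  by rewrite /l1norm (bigD1 j)//= lerDl sumr_ge0.
(* Both terms of [p] are controlled by [l1norm], since atoms bounded by 1 give
   [l2norm <= l1norm]. *)
have pu (x : 'rV[R]_N) : p x <= (1 + r^-1) * \sum_j `|x ord0 j|.
  have r1 : 0 < r^-1 by rewrite invr_gt0.
  have := l1norm_ge0 x; rewrite -/(l1norm x) => x0.
  rewrite ge_max; apply/andP; split; first by nra.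
  apply: (@le_trans _ _ (l1norm x / r)); last by nra.
  by rewrite ler_wpM2r ?(ltW r1)// l2norm_mixture_le.
have c0 : 0 < 1 + r^-1 by rewrite addr_gt0// invr_gt0.
have half0 : 0 < 2^-1 :> R by rewrite invr_gt0.
have [s [ss s2 net]] := exists_half_net pD pZ half0 pl c0 pu.
exists s; split=> //.
  move=> v /s2; rewrite ge_max ler_pdivrMr// ler_pdivrMr// => /andP[v1 v2].
  by split => //; lra.
move=> X M XD XZ XM v v1 v2.
apply: (half_net_bound pZ half0 pl net XD XZ XM).
rewrite ge_max !ler_pdivrMr// !mul1r; exact/andP.
Qed.

End Mixtures.
End Dictionary.

Section DeviationLinear.
Context {R : realType} {d : measure_display} {U : measurableType d}.
Variables (P : probability U R) (n : nat) (z : 'I_n -> U).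
Implicit Types Y : U -> R.

Lemma deviationD Y Y' : bounded_measurable Y -> bounded_measurable Y' ->
  deviation P z (fun x => Y x + Y' x) = deviation P z Y + deviation P z Y'.
Proof. by move=> bY bY'; rewrite /deviation meanD// big_split/= mulrDr; ring. Qed.

Lemma deviationZ (a : R) Y : bounded_measurable Y ->
  deviation P z (fun x => a * Y x) = a * deviation P z Y.
Proof. by move=> bY; rewrite /deviation meanZ// -mulr_sumr; ring. Qed.

Lemma deviation_sum (I : Type) (s : seq I) (Q : pred I) (F : I -> U -> R) :
  (forall i, bounded_measurable (F i)) ->
  deviation P z (fun x => \sum_(i <- s | Q i) F i x) =
  \sum_(i <- s | Q i) deviation P z (F i).
Proof.
move=> bF; rewrite /deviation mean_sum// exchange_big/= sumrB; congr (_ - _).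
by rewrite mulr_sumr.
Qed.

Lemma deviation_norm_le Y (c : R) : (0 < n)%N -> measurable_fun setT Y ->
  (forall x, `|Y x| <= c) -> `|deviation P z Y| <= 2 * c.
Proof.
move=> n0 mY Yc; rewrite mulr2n mulrDl mul1r (le_trans (ler_normB _ _))// lerD//.
  rewrite normrM ger0_norm ?invr_ge0// ler_pdivrMl ?ltr0n//.
  apply: (le_trans (ler_norm_sum _ _ _)); apply: (@le_trans _ _ (\sum_(i < n) c)).
    by apply: ler_sum.
  by rewrite sumr_const card_ord mulr_natl.
exact: mean_norm_le.
Qed.

End DeviationLinear.

Section Uniform.
Context {R : realType} {dO dS dT : measure_display} {Omega : measurableType dO}.
Context {S : measurableType dS} {T : measurableType dT}.
Variables (Pr : probability Omega R) (P : probability (S * T)%type R).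
Variables (n N : nat) (Z : 'I_n -> {RV Pr >-> (S * T)%type}).
Hypothesis n_gt0 : (0 < n)%N.
Hypothesis iidZ : iid_sample P Z.
Variable h : 'I_N -> S -> R.
Hypothesis mh : forall j, measurable_fun setT (h j).
Hypothesis h1 : forall j x, `|h j x| <= 1.
Variable J : {set 'I_N}.

Definition outside_l1norm (w : 'rV[R]_N) : R := \sum_(j | j \notin J) `|w ord0 j|.

(** The atoms of [J] are reindexed by ordinals, so that the net lives in dimension [#|J|]. *)
Let hJ (k : 'I_#|J|) : S -> R := h (enum_val k).
Let resJ (w : 'rV[R]_N) : 'rV[R]_#|J| := \row_k w ord0 (enum_val k).
Let mhJ k : measurable_fun setT (hJ k). Proof. exact: mh. Qed.
Let hJ1 k x : `|hJ k x| <= 1. Proof. exact: h1. Qed.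

Let outside_part (w : 'rV[R]_N) (z : S * T) : R :=
  \sum_(j | j \notin J) w ord0 j * h j z.1.

Let b_outside w : bounded_measurable (outside_part w).
Proof.
apply: bounded_measurable_sum => j; apply: bounded_measurableZ.
exact: bounded_measurable_atom.
Qed.

Let mixture_split w z :
  mixture_pair h w z = mixture_pair hJ (resJ w) z + outside_part w z.
Proof.
rewrite /mixture_pair /mixture (bigID (fun j => j \in J))/=; congr (_ + _).
rewrite big_enum_val; apply: eq_bigr => k _; by rewrite mxE.
Qed.

Let outside_part_le w z : `|outside_part w z| <= outside_l1norm w.
Proof.
apply: (le_trans (ler_norm_sum _ _ _)); apply: ler_sum => j _.
by rewrite normrM ler_piMr.
Qed.

Lemma outside_l1norm_ge0 w : 0 <= outside_l1norm w.
Proof. exact: sumr_ge0. Qed.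

Let l1norm_resJ w : l1norm (resJ w) <= l1norm w.
Proof.
rewrite /l1norm [leRHS](bigID (fun j => j \in J))/= [X in _ <= X + _]big_enum_val.
under [leLHS]eq_bigr do rewrite mxE.
by rewrite lerDl sumr_ge0.
Qed.

(** The part inside [J] is [f_w] minus the part outside, whose supremum is at most
    [outside_l1norm w]. *)
Let l2norm_resJ w : l2norm P (mixture_pair hJ (resJ w)) <=
  l2norm P (mixture_pair h w) + outside_l1norm w.
Proof.
have -> : mixture_pair hJ (resJ w) =
    (fun z : S * T => mixture_pair h w z + - outside_part w z).
  by apply/funext => z; rewrite mixture_split addrK.
apply: (le_trans (ler_l2normD _ _ _)).
- exact: bounded_measurable_mixture.
- exact: bounded_measurableN.
rewrite lerD2l l2normN l2norm_le// ?outside_l1norm_ge0//.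
Qed.

(** The [N] atoms and the at most [22 ^ #|J|] net points each give one two-sided Chernoff event; on
    their intersection the rest is deterministic. The 300 is 200 from the net, with its factor 2,
    plus 100 from the atoms. *)
Lemma uniform_deviation (g : S * T -> R) (b r L : R) :
  measurable_fun setT g -> (forall z, `|g z| <= b) -> 1 <= b ->
  0 < r -> n%:R * r ^+ 2 = L ->
  with_probability_ge Pr (1 - (N + 22 ^ #|J|)%:R * (2 * expR (- (12 * L))))
    (fun om => forall w, l1norm w <= 2 ->
      `|deviation P (fun i => Z i om) (fun z => g z * mixture_pair h w z)| <=
      300 * b * ((l2norm P (mixture_pair h w) + outside_l1norm w) * r + r ^+ 2)).
Proof.
move=> mg gb b1 r0 nrL.
have b0 : 0 < b by lra.
have bg : bounded_measurable g by split => //; exists b.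
have L0 : 0 <= L by rewrite -nrL mulr_ge0// sqr_ge0.
have [s [ss s2 net]] := mixture_net P mhJ hJ1 r0.
have bgJ v : bounded_measurable (fun z => g z * mixture_pair hJ v z).
  exact/bounded_measurableM/bounded_measurable_mixture.
have bgh j : bounded_measurable (fun z => g z * h j z.1).
  exact/bounded_measurableM/bounded_measurable_atom.
have atoms : with_probability_ge Pr (1 - N%:R * (2 * expR (- (12 * L))))
    (fun om => forall j, j \in enum 'I_N ->
     `|deviation P (fun i => Z i om) (fun z => g z * h j z.1)| <= 100 * b * r).
  rewrite -{1}(size_enum_ord N); apply: with_probability_ge_all => j _.
  have gh_le z : `|g z * h j z.1| <= b.
    by rewrite normrM (le_trans _ (gb z))// ler_piMr.
  (* The choice [s = r / (2 * b)] below requires [r <= 1]; for larger [r] the trivial bound [2 * b]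
     is enough. *)
  have [r1|r1] := leP r 1; last first.
    exists setT; split => //.
      rewrite [X in (_ <= X)%E]probability_setT lee_fin gerBl.
      by rewrite mulr_ge0// expR_ge0.
    move=> om _; apply: (le_trans (deviation_norm_le P _ n_gt0 (bgh j).1 gh_le)).
    nra.
  (* With second moment at most [b ^+ 2], the exponent is [(1/2 - 50) * L]. *)
  apply: with_probability_ge_le (deviation_bound (s := r / (2 * b))
     (v := b ^+ 2) iidZ (100 * b * r) n_gt0 (bgh j) _ _ _).
  - rewrite lerB// ler_wpM2l// ler_expR.
    have -> : n%:R * (2 * (r / (2 * b)) ^+ 2 * b ^+ 2 - r / (2 * b) * (100 * b * r)) =
       (1/2 - 50) * (n%:R * r ^+ 2) by field; rewrite gt_eqF.
    by rewrite nrL; lra.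
  - by [].
  - move=> x; apply: (@le_trans _ _ (r / (2 * b) * b)).
      by rewrite ler_wpM2l// divr_ge0// ?mulr_ge0 ?(ltW b0) ?(ltW r0).
    have -> : r / (2 * b) * b = r / 2 by field; rewrite gt_eqF.
    lra.
  - rewrite -[leRHS](mean_cst P); apply: le_mean.
    + exact: bounded_measurable_sqr.
    + exact: bounded_measurable_cst.
    + move=> x; rewrite -[X in X <= _]real_normK ?num_real//.
      by rewrite lerXn2r ?nnegrE// ltW.
  - by rewrite divr_ge0// ?mulr_ge0 ?(ltW b0) ?(ltW r0).
have points : with_probability_ge Pr (1 - (size s)%:R * (2 * expR (- (12 * L))))
    (fun om => forall v, v \in s ->
     `|deviation P (fun i => Z i om) (fun z => g z * mixture_pair hJ v z)|
     <= 100 * b * r ^+ 2).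
  apply: with_probability_ge_all => v /s2[v4 v2r].
  have gh_le z : `|g z * mixture_pair hJ v z| <= b * 4.
    rewrite normrM ler_pM// (le_trans _ v4)//; exact: norm_mixture_le.
  (* The bound [4 * b] allows a constant [s], and the second moment is of order [r ^+ 2]. The
     exponent is [- (99/8) * L], which is below [- 12 * L]. *)
  apply: with_probability_ge_le (deviation_bound (s := (8 * b)^-1)
     (v := b ^+ 2 * (2 * r) ^+ 2) iidZ (100 * b * r ^+ 2) n_gt0 (bgJ v) _ _ _).
  - rewrite lerB// ler_wpM2l// ler_expR.
    have -> : n%:R * (2 * (8 * b)^-1 ^+ 2 * (b ^+ 2 * (2 * r) ^+ 2) -
         (8 * b)^-1 * (100 * b * r ^+ 2)) =
       (1/8 - 100/8) * (n%:R * r ^+ 2) by field; rewrite gt_eqF.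
    by rewrite nrL; lra.
  - by [].
  - move=> x; apply: (@le_trans _ _ ((8 * b)^-1 * (b * 4))).
      by rewrite ler_wpM2l// invr_ge0 ?mulr_ge0 ?(ltW b0).
    have -> : (8 * b)^-1 * (b * 4) = 2^-1 by field; rewrite gt_eqF.
    by [].
  - have bm2 : bounded_measurable (fun z : S * T => mixture_pair hJ v z ^+ 2).
      exact/bounded_measurable_sqr/bounded_measurable_mixture.
    apply: (@le_trans _ _ (\int[P]_z (b ^+ 2 * mixture_pair hJ v z ^+ 2))).
      apply: le_mean.
      + exact: bounded_measurable_sqr.
      + exact: bounded_measurableZ.
      + move=> z; rewrite exprMn ler_wpM2r ?sqr_ge0//.
        rewrite -[X in X <= _]real_normK ?num_real//.
        by rewrite lerXn2r ?nnegrE// ltW.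
    rewrite meanZ// ler_wpM2l ?sqr_ge0// -l2norm_sqr.
    by rewrite lerXn2r ?nnegrE ?l2norm_ge0// mulr_ge0// ltW.
  - by rewrite invr_ge0 ?mulr_ge0 ?(ltW b0).
apply: with_probability_ge_le (with_probability_ge_and atoms points).
  rewrite -mulrDl -natrD lerB// ler_wpM2r ?mulr_ge0 ?expR_ge0//.
  by rewrite ler_nat leq_add2l.
move=> om [Hatoms Hpoints] w w2.
set z := fun i => Z i om.
set delta := l2norm P _; set Delta := outside_l1norm w.
have delta0 : 0 <= delta by exact: l2norm_ge0.
have Delta0 : 0 <= Delta by exact: outside_l1norm_ge0.
have -> : (fun x => g x * mixture_pair h w x) = (fun x : S * T =>
    g x * mixture_pair hJ (resJ w) x +
    \sum_(j | j \notin J) w ord0 j * (g x * h j x.1)).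
  apply/funext => x; rewrite mixture_split mulrDr; congr (_ + _).
  by rewrite mulr_sumr; apply: eq_bigr => j _; rewrite mulrCA.
rewrite deviationD//; last first.
  by apply: bounded_measurable_sum => j; exact: bounded_measurableZ.
rewrite (le_trans (ler_normD _ _))//.
have H1 : `|deviation P z (fun x => \sum_(j | j \notin J) w ord0 j * (g x * h j x.1))|
    <= Delta * (100 * b * r).
  rewrite deviation_sum; last by move=> j; exact: bounded_measurableZ.
  rewrite (le_trans (ler_norm_sum _ _ _))// mulr_suml; apply: ler_sum => j _.
  by rewrite deviationZ// normrM ler_wpM2l// Hatoms// mem_enum.
(* Since [k * r = r + delta + Delta] and [1 <= k], dividing [resJ w] by [k] brings it within the
   reach of the net. *)
pose k := 1 + (delta + Delta) / r.
have k1 : 1 <= k by rewrite lerDl divr_ge0 ?addr_ge0 ?(ltW r0).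
have k0 : 0 < k by lra.
(* By linearity the bound at radius [r] propagates to every radius. *)
have H2 : `|deviation P z (fun x => g x * mixture_pair hJ (resJ w) x)| <=
    k * (2 * (100 * b * r ^+ 2)).
  pose X v := deviation P z (fun x => g x * mixture_pair hJ v x).
  have XD v v' : X (v + v') = X v + X v'.
    rewrite /X -deviationD//; congr deviation; apply/funext => x.
    by rewrite -mulrDr; congr (_ * _); exact: mixtureD.
  have XZ a v : X (a *: v) = a * X v.
    rewrite /X -deviationZ//; congr deviation; apply/funext => x.
    by rewrite mulrCA; congr (_ * _); exact: mixtureZ.
  have := net X _ XD XZ Hpoints (k^-1 *: resJ w).
  rewrite l1normZ l2norm_mixtureZ// XZ normrM gtr0_norm ?invr_gt0//.
  rewrite !ler_pdivrMl//; apply.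
    by have := l1norm_resJ w; nra.
  have := l2norm_resJ w; rewrite -/delta -/Delta => H.
  apply: (le_trans H); rewrite /k mulrDl mul1r divfK ?gt_eqF//.
  by rewrite lerDr ltW.
apply: (le_trans (lerD H2 H1)).
have -> : k * (2 * (100 * b * r ^+ 2)) = 200 * b * ((delta + Delta) * r + r ^+ 2).
  by rewrite /k; field; rewrite gt_eqF.
have br : 0 <= b * r by rewrite mulr_ge0 ?ltW.
have h2 : 0 <= (b * r) * delta by exact: mulr_ge0.
have h3 : 0 <= b * r ^+ 2 by rewrite mulr_ge0 ?sqr_ge0 ?ltW.
have h4 : 0 <= (b * r) * Delta by exact: mulr_ge0.
have -> : 300 * b * ((delta + Delta) * r + r ^+ 2) =
  200 * b * ((delta + Delta) * r + r ^+ 2) + 100 * ((b * r) * delta + (b * r) * Delta + b * r ^+ 2).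
  ring.
lra.
Qed.

End Uniform.

(** Since [22 <= expR 12], the factor [22 ^ d] is absorbed. With [x] for [N ^ (- A)], the left side
    is then at most [8 * N^2 * x^12], and [N * x <= 1] and [x <= 1/2] conclude. *)
Lemma union_bound_le_powR {R : realType} (N d : nat) (A : R) : (1 < N)%N -> 1 <= A ->
  N.+1%:R * ((N + 22 ^ d)%:R * (2 * expR (- (12 * (d%:R + A * ln N%:R)))))
    <= N%:R `^ (- A) :> R.
Proof.
move=> N1 A1; have N0 : 0 < N%:R :> R by rewrite ltr0n; lia.
have N2 : 2 <= N%:R :> R by rewrite ler_nat.
pose x : R := N%:R `^ (- A).
have x0 : 0 < x by exact: powR_gt0.
have Nx : N%:R * x <= 1.
  rewrite /x -{1}(powRr1 (ltW N0)) -powRD; last by rewrite (gt_eqF N0) implybT.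
  rewrite -[leRHS](powRr0 (N%:R : R)) ler_powR//; lra.
have xE : expR (- (12 * (A * ln N%:R))) = x ^+ 12.
  by rewrite /x /powR gt_eqF// -expRM_natl; congr expR; ring.
have dE : (22 ^ d)%:R * expR (- (12 * d%:R)) <= 1 :> R.
  rewrite expRN ler_pdivrMr ?expR_gt0// mul1r natrX mulrC expRM_natl.
  rewrite lerXn2r ?nnegrE ?expR_ge0//.
  apply: (@le_trans _ _ (2 ^+ 12)); first by rewrite -natrX ler_nat.
  rewrite -[X in expR X]mulr1 expRM_natl lerXn2r ?nnegrE ?expR_ge0//.
  have := expR_ge1Dx (1 : R); lra.
have e1 : expR (- (12 * d%:R)) <= 1 :> R.
  by rewrite expR_le1 oppr_le0 mulr_ge0.
rewrite -/x mulrDr opprD expRD xE.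
set e := expR _ in dE e1 *; have e0 : 0 <= e by exact: expR_ge0.
have S1 : N.+1%:R <= 2 * N%:R :> R by rewrite -natrM ler_nat; lia.
have S2 : (N + 22 ^ d)%:R * e <= 2 * N%:R :> R.
  by rewrite natrD mulrDl; nra.
apply: (@le_trans _ _ (2 * N%:R * (2 * N%:R * (2 * x ^+ 12)))).
  have x12' : 0 <= x ^+ 12 by rewrite exprn_ge0// ltW.
  have x12 : 0 <= 2 * x ^+ 12 by rewrite mulr_ge0// exprn_ge0// ltW.
  apply: ler_pM => //; first by do 2 (apply: mulr_ge0 => //); apply: mulr_ge0.
  by rewrite (_ : _ * (2 * _) = (N + 22 ^ d)%:R * e * (2 * x ^+ 12)) ?ler_wpM2r//; ring.
have -> : 2 * N%:R * (2 * N%:R * (2 * x ^+ 12)) = (N%:R * x) ^+ 2 * (8 * x ^+ 9) * x.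
  by ring.
rewrite ger_pMl//.
have x2 : x <= 2^-1 by nra.
have x9 : 8 * x ^+ 9 <= 1.
  have : x ^+ 9 <= 2^-1 ^+ 9 by rewrite lerXn2r ?nnegrE// ltW.
  lra.
apply: mulr_ile1 => //.
- by rewrite sqr_ge0.
- by rewrite mulr_ge0// exprn_ge0// ltW.
- by rewrite expr_le1// mulr_ge0// ltW.
Qed.

Section AllDeviations.
Context {R : realType} {dO dS dT : measure_display} {Omega : measurableType dO}.
Context {S : measurableType dS} {T : measurableType dT}.
Variables (Pr : probability Omega R) (P : probability (S * T)%type R).

(** One event serves the [N.+1] multipliers [g, h_1, ..., h_N], all bounded by [b] as [1 <= b]. The
    factor 2 of the quadratic bound is the bound on [l1norm w]. *)
Lemma linear_quadratic_deviation (n N : nat) (Z : 'I_n -> {RV Pr >-> (S * T)%type})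
    (h : 'I_N -> S -> R) (J : {set 'I_N}) (A b : R) (g : S * T -> R) :
  (0 < n)%N -> iid_sample P Z ->
  (forall j, measurable_fun setT (h j)) -> (forall j x, `|h j x| <= 1) ->
  measurable_fun setT g -> (forall z, `|g z| <= b) -> 1 <= b ->
  (1 < N)%N -> 1 <= A ->
  let r := Num.sqrt ((#|J|%:R + A * ln N%:R) / n%:R) in
  with_probability_ge Pr (1 - N%:R `^ (- A))
    (fun om => forall w, l1norm w <= 2 ->
      let B := 300 * b * ((l2norm P (mixture_pair h w) + outside_l1norm J w) * r + r ^+ 2) in
      `|deviation P (fun i => Z i om) (fun z => g z * mixture_pair h w z)| <= B /\
      `|deviation P (fun i => Z i om) (fun z => mixture_pair h w z ^+ 2)| <= 2 * B).
Proof.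
move=> n0 iidZ mh h1 mg gb b1 N1 A1 r.
have lnN : 0 < ln N%:R :> R by rewrite ln_gt0// ltr1n.
have n0' : 0 < n%:R :> R by rewrite ltr0n.
have rate0 : 0 < (#|J|%:R + A * ln N%:R) / n%:R :> R.
  by rewrite divr_gt0// ltr_wpDl// mulr_gt0//; lra.
have r0 : 0 < r by rewrite sqrtr_gt0.
have nrL : n%:R * r ^+ 2 = #|J|%:R + A * ln N%:R.
  by rewrite sqr_sqrtr ?ltW// mulrC divfK// gt_eqF.
pose G (k : option 'I_N) : S * T -> R :=
  if k is Some j then fun z => h j z.1 else g.
have mG k : measurable_fun setT (G k).
  by case: k => [j|//]; exact: (bounded_measurable_atom mh h1 j).1.
have Gb k z : `|G k z| <= b.
  by case: k => [j|]//=; exact: le_trans (h1 _ _) b1.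
apply: with_probability_ge_le (with_probability_ge_all (s := enum {: option 'I_N})
  (fun k _ => uniform_deviation n0 iidZ mh h1 J (mG k) (Gb k) b1 r0 nrL)).
  rewrite lerB// -cardE card_option card_ord; exact: union_bound_le_powR.
move=> om H w w2 B.
have Hk k := H k (mem_enum _ k) w w2.
split; first exact: (Hk None).
have bm : bounded_measurable (mixture_pair h w : S * T -> R).
  exact: bounded_measurable_mixture.
have bmj j : bounded_measurable (fun z : S * T => h j z.1 * mixture_pair h w z).
  by apply: bounded_measurableM => //; exact: bounded_measurable_atom.
(* [f_w ^ 2] is the linear combination of the [h_j f_w] with weights [w_j]. *)
have -> : (fun z : S * T => mixture_pair h w z ^+ 2) =
    (fun z => \sum_j w ord0 j * (h j z.1 * mixture_pair h w z)).
  apply/funext => z; rewrite expr2 {1}/mixture_pair /mixture mulr_suml.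
  by apply: eq_bigr => j _; rewrite mulrA.
rewrite deviation_sum; last by move=> j; exact: bounded_measurableZ.
apply: (le_trans (ler_norm_sum _ _ _)).
have B0 : 0 <= B by exact: le_trans (Hk None).
apply: (@le_trans _ _ (\sum_j `|w ord0 j| * B)); last first.
  by rewrite -mulr_suml ler_wpM2r.
apply: ler_sum => j _; rewrite deviationZ// normrM ler_wpM2l//.
exact: (Hk (Some j)).
Qed.

End AllDeviations.

(** * Regularity of the loss *)

(** The intermediate point is located by its distance to [a] and its absolute value, so that [a] and
    [b] need not be ordered. *)
Lemma mean_value {R : realType} (f : R -> R) : (forall x, derivable f x 1) ->
  forall a b : R, exists2 c : R, `|c - a| <= `|b - a| /\ `|c| <= Num.max `|a| `|b| &
    f b - f a = derive1 f c * (b - a).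
Proof.
move=> df.
have der (x : R) : is_derive x (1 : R) f (derive1 f x).
  by rewrite derive1E; apply: DeriveDef.
have cont (a b : R) : {within `[a, b], continuous f}.
  apply: continuous_subspaceT => x /=.
  by apply: differentiable_continuous; apply/derivable1_diffP.
have main (a b : R) : a <= b -> exists2 c, a <= c <= b & f b - f a = derive1 f c * (b - a).
  move=> ab; have [c] := MVT_segment ab (fun x _ => der x) (cont a b).
  by rewrite in_itv/= => cab E; exists c.
have normc (a b c : R) : a <= c -> c <= b -> `|c| <= Num.max `|a| `|b|.
  move=> ac cb; have := ler_norm b; have := ler_norm (- a); rewrite normrN le_max.
  move=> Ha Hb; have [c0|c0] := leP 0 c.
    by rewrite ger0_norm//; apply/orP; right; lra.
  by rewrite ltr0_norm//; apply/orP; left; lra.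
move=> a b; have [ab|/ltW ba] := leP a b.
  have [c /andP[ac cb] E] := main a b ab; exists c => //; split; last exact: normc.
  by rewrite !ger0_norm ?subr_ge0// lerB.
have [c /andP[bc ca] E] := main b a ba; exists c; last first.
  by rewrite -opprB E -mulrN opprB.
split; last by rewrite maxC; exact: normc.
by rewrite distrC [leRHS]distrC !ger0_norm ?subr_ge0// lerB.
Qed.

Section LossFacts.
Context {R : realType} {dT : measure_display} {T : measurableType dT}.
Variables (l : T -> R -> R).
Hypothesis hl : loss_function l.

(** The mean value theorem is used for the loss between [u] and [v], then for its derivative between
    [u] and the intermediate point; this yields the constant [B], weaker than Taylor's [B / 2]. *)
Lemma loss_tangent_upper (B : R) : (forall y u, `|loss_d2 l y u| <= B) ->
  forall y u v, l y v <= l y u + loss_d1 l y u * (v - u) + B * (v - u) ^+ 2.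
Proof.
move=> hB y u v.
have [c [cuv _] E] := mean_value (@loss_derivable1 _ _ _ _ hl y) u v.
have [c' _ E'] := mean_value (@loss_derivable2 _ _ _ _ hl y) u c.
have -> : l y v = l y u + derive1 (l y) c * (v - u) by rewrite -E addrC subrK.
have H : (loss_d1 l y c - loss_d1 l y u) * (v - u) <= B * (v - u) ^+ 2.
  rewrite E' (le_trans (ler_norm _))// !normrM -[X in B * X]real_normK ?num_real//.
  rewrite expr2 mulrA ler_wpM2r// ler_pM//; exact: hB.
by move: H; rewrite /loss_d1; nra.
Qed.

Lemma loss_d1_bound (B1 B : R) : (forall y, `|loss_d1 l y 0| <= B1) ->
  (forall y u, `|loss_d2 l y u| <= B) ->
  forall y u, `|u| <= 1 -> `|loss_d1 l y u| <= B1 + B.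
Proof.
move=> hB1 hB y u u1.
have [c _ E] := mean_value (@loss_derivable2 _ _ _ _ hl y) 0 u.
rewrite -[loss_d1 l y u](subrK (loss_d1 l y 0)) E subr0 addrC.
rewrite (le_trans (ler_normD _ _))// lerD// normrM.
rewrite -[B]mulr1 ler_pM//; exact: hB.
Qed.

Lemma loss_bound (B0 B1 B : R) : (forall y, l y 0 <= B0) ->
  (forall y, `|loss_d1 l y 0| <= B1) -> (forall y u, `|loss_d2 l y u| <= B) ->
  forall y u, `|u| <= 1 -> `|l y u| <= B0 + B1 + B.
Proof.
move=> hB0 hB1 hB y u u1.
rewrite ger0_norm ?(loss_ge0 hl)//.
have := loss_tangent_upper hB y 0 u; rewrite subr0 => H.
apply: (le_trans H); rewrite -!addrA; apply: lerD => //; apply: lerD.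
  rewrite (le_trans (ler_norm _))// normrM -[B1]mulr1 ler_pM//.
have B0' : 0 <= B by exact: le_trans (hB y 0).
rewrite -[leRHS]mulr1 ler_wpM2l// -real_normK ?num_real// expr_le1//.
Qed.

(** An [inf] is a lower bound only for sets bounded below; the bound on the second derivative
    provides this. *)
Let d2_lbound (B : R) (hB : forall y u, `|loss_d2 l y u| <= B) (r : R) y :
  lbound [set loss_d2 l y u | u in [set u | `|u| <= r]] (- B).
Proof. by move=> _ [u _ <-]; have := hB y u; rewrite ler_norml => /andP[]. Qed.

Let inf_d2_le (r : R) y u : `|u| <= r ->
  inf [set loss_d2 l y u | u in [set u | `|u| <= r]] <= loss_d2 l y u.
Proof.
move=> ur; have [B hB] := loss_d2_bounded hl; apply: ge_inf; last by exists u.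
by exists (- B); exact: d2_lbound.
Qed.

Let inf_d2_ge (B : R) (hB : forall y u, `|loss_d2 l y u| <= B) (r : R) y :
  0 <= r -> - B <= inf [set loss_d2 l y u | u in [set u | `|u| <= r]].
Proof.
move=> r0; apply: lb_le_inf; last exact: d2_lbound.
by exists (loss_d2 l y 0); exists 0 => //=; rewrite normr0.
Qed.

Let inf_inf_le (r : R) y : 0 <= r ->
  2 * tau l r <= inf [set loss_d2 l y u | u in [set u | `|u| <= r]].
Proof.
move=> r0; have [B hB] := loss_d2_bounded hl.
rewrite /tau mulrA divff// mul1r; apply: ge_inf; last by exists y.
by exists (- B) => _ [y' _ <-]; exact: inf_d2_ge.
Qed.

Lemma tau_le_d2 (y : T) (u r : R) : `|u| <= r -> 2 * tau l r <= loss_d2 l y u.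
Proof.
move=> ur; have r0 : 0 <= r by exact: le_trans ur.
exact: le_trans (inf_inf_le y r0) (inf_d2_le y ur).
Qed.

(** Passes from the radius [Num.max M 1] of the assumption to the radius 1, on which the constants
    of the theorem depend. *)
Lemma tau_anti (r s : R) : 0 <= r -> r <= s -> tau l s <= tau l r.
Proof.
move=> r0 rs; rewrite [leRHS]/tau mulrC ler_pdivlMr// mulrC.
apply: lb_le_inf; first by eexists; exists point.
move=> _ [y _ <-]; apply: lb_le_inf.
  by exists (loss_d2 l y 0); exists 0 => //=; rewrite normr0.
by move=> _ [u ur <-]; apply: tau_le_d2; exact: le_trans ur rs.
Qed.

Lemma loss_d1_strongly_monotone (y : T) (u v : R) : `|u| <= 1 -> `|v| <= 1 ->
  2 * tau l 1 * (v - u) ^+ 2 <= (loss_d1 l y v - loss_d1 l y u) * (v - u).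
Proof.
move=> u1 v1; have [c [_ c1] E] := mean_value (@loss_derivable2 _ _ _ _ hl y) u v.
rewrite E -[leRHS]mulrA -[X in _ <= _ * X]expr2 ler_wpM2r ?sqr_ge0//; apply: tau_le_d2.
by rewrite (le_trans c1)// ge_max u1 v1.
Qed.

(** The derivative is the pointwise limit of difference quotients with steps [k.+1%:R^-1],
    measurable because the loss is jointly measurable. *)
Lemma measurable_loss_d1 {dU} {U : measurableType dU} (f : U -> R) (Y : U -> T) :
  measurable_fun setT f -> measurable_fun setT Y ->
  measurable_fun setT (fun x => loss_d1 l (Y x) (f x)).
Proof.
move=> mf mY.
have mlc (c : R) : measurable_fun setT (fun x => l (Y x) (f x + c)).
  apply: (measurableT_comp (loss_measurable hl)
    (g := fun x => (Y x, f x + c))).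
  by apply/measurable_fun_pairP; split => //=; exact: measurable_funD.
pose q k x := k.+1%:R * (l (Y x) (f x + k.+1%:R^-1) - l (Y x) (f x + 0)).
apply: (@measurable_fun_cvg _ _ _ _ q).
  move=> k; apply: measurable_funM => //; apply: measurable_funB; exact: mlc.
move=> x _; rewrite /loss_d1 derive1E.
have dx : (h^-1 *: (l (Y x) (h *: (1 : R) + f x) - l (Y x) (f x)) @[h --> 0^'] -->
    'D_1 (l (Y x)) (f x)) := @loss_derivable1 _ _ _ _ hl (Y x) (f x).
(* The derivative is a limit along punctured neighbourhoods, and the harmonic sequence never
   vanishes. *)
have h0 : @harmonic R k @[k --> \oo] --> (0 : R)^'.
  move=> A A0.
  have H : \forall k \near \oo, @harmonic R k != 0 -> A (harmonic k) := @cvg_harmonic R _ A0.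
  change (\forall k \near \oo, A (@harmonic R k)).
  by apply: filterS H => k; apply; rewrite gt_eqF// invr_gt0.
apply: cvg_trans (cvg_comp _ _ h0 dx).
apply: near_eq_cvg; near=> k.
rewrite /q /= /harmonic/= invrK addr0 /GRing.scale/= mulr1.
by rewrite [f x + _]addrC.
Unshelve. all: by end_near.
Qed.

End LossFacts.

(** * First-order conditions on the simplex *)

Section Log.
Context {R : realType}.
Implicit Types x y : R.

Lemma ler_ln_tangent x y : 0 < x -> 0 < y -> ln x <= ln y + (x - y) / y.
Proof.
move=> x0 y0; rewrite -lerBlDl -ln_div//.
have := @le_ln1Dx R (x / y - 1); rewrite [1 + _]addrC subrK.
have -> : (x - y) / y = x / y - 1 by rewrite mulrBl divff// gt_eqF.
by apply; rewrite ltrBrDl subrr divr_gt0.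
Qed.

(** The tangent at [x] lies below the graph. The value [y = 0] is included because it is applied
    before the minimizer is known to have positive entries. *)
Lemma xlnx_convex x y : 0 < x -> 0 <= y ->
  x * ln x - y * ln y <= (x - y) * (ln x + 1).
Proof.
rewrite le_eqVlt => x0 /predU1P[<-|y0]; first by rewrite mul0r !subr0 mulrDr; lra.
have := ler_ln_tangent x0 y0; rewrite -(ler_pM2l y0) mulrDr mulrCA divff ?gt_eqF//.
lra.
Qed.

(* Holds whatever the sign of [w], although [ln] is only bounded on one side by
   its tangent. *)
Lemma weighted_ln_increment x w t : 0 < x -> 0 <= t -> t <= 2^-1 -> 0 <= x + w ->
  w * ln (x + t * w) <= w * ln x + t * (2 * w ^+ 2 / x).
Proof.
move=> x0 t0 t2 xw.
(* Indeed [x + t * w = (1 - t) * x + t * (x + w)]. *)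
have xtw : x / 2 <= x + t * w by nra.
have xtw0 : 0 < x + t * w by lra.
have [w0|w0] := leP 0 w.
  have := ler_ln_tangent xtw0 x0; rewrite addrAC subrr add0r => H.
  have := ler_wpM2l w0 H; rewrite mulrDr => /le_trans; apply.
  rewrite lerD2l.
  have -> : w * (t * w / x) = t * (w ^+ 2 / x) by ring.
  by rewrite ler_wpM2l// ler_wpM2r ?invr_ge0 ?(ltW x0)//; have := sqr_ge0 w; lra.
have := ler_ln_tangent x0 xtw0; rewrite opprD addrA subrr add0r => H.
have H1 : ln x - t * w * - (x + t * w)^-1 <= ln (x + t * w).
  by move: H; rewrite mulrN mulNr; lra.
have := ler_wnM2l (ltW w0) H1 => /le_trans; apply.
rewrite mulrBr lerD2l.
have -> : - (w * (t * w * - (x + t * w)^-1)) = t * w ^+ 2 * (x + t * w)^-1 by ring.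
have -> : t * (2 * w ^+ 2 / x) = t * w ^+ 2 * (x / 2)^-1 by field; rewrite gt_eqF.
apply: ler_wpM2l; first by rewrite mulr_ge0 ?sqr_ge0.
by rewrite lef_pV2 ?posrE//; lra.
Qed.

Lemma ln2_ge_half : 2^-1 <= ln 2 :> R.
Proof.
have := @ler_ln_tangent 1 2 ltr01 (ltr0n _ 2); rewrite ln1; lra.
Qed.

Lemma sym_kl_term_ge0 x y : 0 < x -> 0 < y -> 0 <= (x - y) * (ln x - ln y).
Proof.
move=> x0 y0; have [xy|xy] := leP x y.
  by rewrite -mulrNN mulr_ge0// oppr_ge0 subr_le0// ler_ln.
by rewrite mulr_ge0 ?subr_ge0 ?ler_ln ?posrE// ltW.
Qed.

(** If [x] exceeds [2 * y], then [x - y >= x / 2] and the logarithms differ by at least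
    [ln 2 >= 1/2], so the product is at least [x / 4]. Summed over entries, this compares the masses
    of the two minimizers outside [J]. *)
Lemma le_double_add_sym_kl x y : 0 < x -> 0 < y ->
  x <= 2 * y + 4 * ((x - y) * (ln x - ln y)).
Proof.
move=> x0 y0.
have K0 := sym_kl_term_ge0 x0 y0.
have [xy|xy] := leP x (2 * y); first lra.
have : ln 2 <= ln x - ln y.
  by rewrite -ln_div ?posrE// ler_ln ?posrE ?divr_gt0// ler_pdivlMr// ltW.
have := ln2_ge_half; nra.
Qed.

End Log.

Lemma simplex_segment {R : realType} {N : nat} (lam nu : 'rV[R]_N) (t : R) :
  simplex lam -> simplex nu -> 0 <= t -> t <= 1 ->
  simplex (lam + t *: (nu - lam)).
Proof.
move=> [lam0 lam1] [nu0 nu1] t0 t1; split.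
  by move=> j; rewrite !mxE; have := nu0 j; have := lam0 j; nra.
under eq_bigr do rewrite !mxE.
by rewrite big_split/= -mulr_sumr sumrB nu1 lam1 subrr mulr0 addr0.
Qed.

Section FirstOrder.
Context {R : realType} {N : nat}.
Variables (G : 'rV[R]_N -> R) (eps : R) (lam : 'rV[R]_N).
Hypothesis eps_gt0 : 0 < eps.
Hypothesis lam_simplex : simplex lam.
Hypothesis lam_min : forall nu, simplex nu ->
  G lam + eps * neg_entropy lam <= G nu + eps * neg_entropy nu.

(* [D] plays the role of the derivative of [G] at [lam] towards [nu]. *)
Definition tangent_upper (nu : 'rV[R]_N) (D c : R) := forall t, 0 <= t -> t <= 1 ->
  G (lam + t *: (nu - lam)) <= G lam + t * D + c * t ^+ 2.

(** The minimizer is compared with the point at [t] on the segment and the result divided by [t].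
    The entropy slope is taken at that point, as it may be infinite at [lam]. *)
Lemma first_order_segment nu D c t : simplex nu -> tangent_upper nu D c ->
  0 < t -> t <= 1 ->
  (forall j, 0 < lam ord0 j + t * (nu ord0 j - lam ord0 j)) ->
  0 <= D + c * t + eps * \sum_j (nu ord0 j - lam ord0 j) *
        ln (lam ord0 j + t * (nu ord0 j - lam ord0 j)).
Proof.
move=> snu tanD t0 t1 pos.
have := lam_min (simplex_segment lam_simplex snu (ltW t0) t1).
have := tanD t (ltW t0) t1.
set mu := lam + _.
set S := \sum_j _ * _.
have HS : neg_entropy mu - neg_entropy lam <= t * S.
  have [lam0 lam1] := lam_simplex; have [nu0 nu1] := snu.
  have sw : \sum_j (nu ord0 j - lam ord0 j) = 0 by rewrite sumrB nu1 lam1 subrr.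
  (* The constant 1 in the derivative of [x ln x] may be added since the increments sum to 0. *)
  have -> : t * S = \sum_j t * ((nu ord0 j - lam ord0 j) *
      (ln (lam ord0 j + t * (nu ord0 j - lam ord0 j)) + 1)).
    rewrite -mulr_sumr; under [in RHS]eq_bigr do rewrite mulrDr mulr1.
    by rewrite big_split/= sw addr0.
  rewrite -sumrB; apply: ler_sum => j _.
  have -> : mu ord0 j = lam ord0 j + t * (nu ord0 j - lam ord0 j) by rewrite !mxE.
  apply: (le_trans (xlnx_convex (pos j) (lam0 j))).
  by rewrite addrAC subrr add0r mulrA.
have H3 := ler_wpM2l (ltW eps_gt0) HS.
move=> H1 H2; rewrite -(pmulr_rge0 _ t0).
have -> : t * (D + c * t + eps * S) = t * D + c * t ^+ 2 + eps * (t * S) by ring.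
move: H3; rewrite mulrBr; lra.
Qed.

(** At a vanishing entry the entropy has slope minus infinity, so a tiny step towards the positive
    point [nu] would improve on the minimum. *)
Lemma minimizer_gt0 nu D c : simplex nu -> (forall j, 0 < nu ord0 j) ->
  tangent_upper nu D c -> 0 <= c -> forall j, 0 < lam ord0 j.
Proof.
move=> snu nu_gt0 tanD c0 k; have [lam0 lam1] := lam_simplex.
rewrite lt_neqAle lam0 andbT eq_sym; apply/negP => /eqP lamk.
pose w j := nu ord0 j - lam ord0 j.
pose K := D + c + eps * (\sum_(j | j != k) w j * ln (nu ord0 j) + nu ord0 k * ln (nu ord0 k)).
pose t := expR (- ((`|K| + 1) / (eps * nu ord0 k))).
have ek : 0 < eps * nu ord0 k by exact: mulr_gt0.
have t0 : 0 < t by exact: expR_gt0.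
have t1 : t <= 1.
  by rewrite expR_le1 oppr_le0 divr_ge0 ?addr_ge0 ?(ltW ek).
have pos j : 0 < lam ord0 j + t * w j.
  by have := lam0 j; have := nu_gt0 j; rewrite /w; nra.
have := first_order_segment snu tanD t0 t1 pos.
rewrite (bigD1 k)//= lamk subr0 add0r.
rewrite lnM ?posrE// /t expRK.
have H : \sum_(i < N | i != k) (nu ord0 i - lam ord0 i) *
      ln (lam ord0 i + t * (nu ord0 i - lam ord0 i)) <=
    \sum_(j | j != k) w j * ln (nu ord0 j).
  apply: ler_sum => j _; rewrite -/(w j).
  have nuE : nu ord0 j = lam ord0 j + w j by rewrite /w addrC subrK.
  have [w0|w0] := leP 0 (w j).
    by rewrite ler_wpM2l// ler_ln ?posrE// [leRHS]nuE; nra.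
  apply: ler_wnM2l; first exact: ltW.
  by rewrite ler_ln ?posrE// [leLHS]nuE; nra.
have H' := ler_wpM2l (ltW eps_gt0) H.
have ct : c * t <= c by rewrite ler_piMr.
move: ct; rewrite /t => ct; rewrite -/t in H' ct *.
rewrite mulrDr (mulrDr (nu ord0 k)) mulrDr.
have -> : eps * (nu ord0 k * - ((`|K| + 1) / (eps * nu ord0 k))) = - (`|K| + 1).
  by field; rewrite !gt_eqF.
have := ler_norm K; rewrite /K mulrDr; lra.
Qed.

(** Limit of [first_order_segment] as [t] tends to 0: entries are now positive, so
    [weighted_ln_increment] makes the error linear in [t]. *)
Lemma minimizer_first_order nu D c : simplex nu -> (forall j, 0 < lam ord0 j) ->
  tangent_upper nu D c ->
  0 <= D + eps * \sum_j (nu ord0 j - lam ord0 j) * ln (lam ord0 j).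
Proof.
move=> snu lam_gt0 tanD; have [nu0 nu1] := snu.
pose w j := nu ord0 j - lam ord0 j.
set S := \sum_j _.
pose Q := \sum_j 2 * w j ^+ 2 / lam ord0 j.
have Q0 : 0 <= Q.
  apply: sumr_ge0 => j _.
  by rewrite divr_ge0 ?(ltW (lam_gt0 j))// mulr_ge0 ?sqr_ge0.
have small t : 0 < t -> t <= 2^-1 -> 0 <= D + eps * S + (`|c| + eps * Q) * t.
  move=> t0 t2.
  have pos j : 0 < lam ord0 j + t * w j.
    by have := lam_gt0 j; have := nu0 j; rewrite /w; nra.
  have t1 : t <= 1 by lra.
  have := first_order_segment snu tanD t0 t1 pos.
  have H : \sum_j (nu ord0 j - lam ord0 j) *
       ln (lam ord0 j + t * (nu ord0 j - lam ord0 j)) <= S + t * Q.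
    rewrite /S /Q mulr_sumr -big_split/=; apply: ler_sum => j _.
    apply: weighted_ln_increment => //; first exact: ltW.
    by rewrite addrC subrK.
  have H' := ler_wpM2l (ltW eps_gt0) H.
  have : c * t <= `|c| * t by rewrite ler_wpM2r ?(ltW t0)// ler_norm.
  move: H'; rewrite mulrDr; nra.
pose q := `|c| + eps * Q + 1.
have q0 : 0 < q by rewrite /q ltr_wpDl// addr_ge0// mulr_ge0// ltW.
rewrite -oppr_le0; apply/ler_addgt0Pr => e e0.
pose t := Num.min 2^-1 (e / q).
have t0 : 0 < t by rewrite lt_min divr_gt0// andbT invr_gt0.
have := small t t0; rewrite ge_min lexx => /(_ isT).
have : t * q <= e by rewrite -ler_pdivlMr// ge_min lexx orbT.
rewrite /q; nra.
Qed.

End FirstOrder.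

Lemma sym_KL_fin {R : realType} {N : nat} (lam nu : 'rV[R]_N) :
  (forall j, 0 < lam ord0 j) -> (forall j, 0 < nu ord0 j) ->
  sym_KL lam nu = (\sum_j (lam ord0 j - nu ord0 j) *
    (ln (lam ord0 j) - ln (nu ord0 j)))%:E.
Proof.
move=> l0 n0; rewrite /sym_KL /KL -big_split/= -sumEFin; apply: eq_bigr => j _.
rewrite /kl_term !gt_eqF// -EFinD !ln_div ?posrE//; congr EFin; ring.
Qed.

(** * The oracle inequalities *)

(** Here [m] and [mh] are the masses outside [J]. Young's inequality absorbs the term in
    [delta * r]; the lower bound on [eps] then bounds [K] by the masses, and the comparison of
    masses closes the loop. *)
Lemma oracle_algebra {R : realType} (a c r eps delta m mh K Delta : R) :
  0 < a -> 0 < c -> 0 < r -> 0 <= delta -> 0 <= m -> 0 <= mh -> 0 <= K ->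
  Delta <= m + mh ->
  a * delta ^+ 2 + eps * K <= c * ((delta + Delta) * r + r ^+ 2) ->
  let c' := c + c ^+ 2 / (2 * a) in
  8 * c' * r <= eps -> mh <= 2 * m + 4 * K -> m <= 2 * mh + 4 * K ->
  let C := 5 + (1 + 2 / a) * (8 * c') in
  [/\ mh <= C * (m + r), m <= C * (mh + r) &
      delta ^+ 2 + eps * K <= C * Num.max (r ^+ 2) (m * r)].
Proof.
move=> a0 c0 r0 d0 m0 mh0 K0 DeltaE main c' epsE mhE mE C.
have c'0 : 0 < c' by rewrite addr_gt0// divr_gt0 ?exprn_gt0// mulr_gt0.
have young : c * delta * r <= a / 2 * delta ^+ 2 + c ^+ 2 / (2 * a) * r ^+ 2.
  rewrite -subr_ge0.
  have -> : a / 2 * delta ^+ 2 + c ^+ 2 / (2 * a) * r ^+ 2 - c * delta * r =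
     (a * delta - c * r) ^+ 2 / (2 * a) by field; rewrite gt_eqF.
  by rewrite divr_ge0 ?sqr_ge0// mulr_ge0// ltW.
have Er : 8 * c' * r * K <= eps * K by rewrite ler_wpM2r.
have mr : 0 <= (m + mh) * r by rewrite mulr_ge0 ?addr_ge0// ltW.
have q0 : 0 <= c ^+ 2 / (2 * a) by rewrite divr_ge0 ?sqr_ge0// mulr_ge0// ltW.
have cD : c * (Delta * r) <= c * ((m + mh) * r).
  by rewrite ler_pM2l// ler_pM2r.
have main2 : a / 2 * delta ^+ 2 + eps * K <= c' * ((m + mh) * r + r ^+ 2).
  have qmr := mulr_ge0 q0 mr.
  have -> : c' * ((m + mh) * r + r ^+ 2) = c * ((m + mh) * r) + c * r ^+ 2 +
     c ^+ 2 / (2 * a) * ((m + mh) * r) + c ^+ 2 / (2 * a) * r ^+ 2.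
    by rewrite /c'; ring.
  have : c * ((delta + Delta) * r + r ^+ 2) = c * delta * r + c * (Delta * r) + c * r ^+ 2.
    by ring.
  lra.
have K8 : 8 * K <= m + mh + r.
  have : c' * r * (8 * K) <= c' * r * (m + mh + r).
    have : 0 <= a / 2 * delta ^+ 2 by rewrite mulr_ge0 ?sqr_ge0// divr_ge0// ltW.
    have -> : c' * r * (m + mh + r) = c' * ((m + mh) * r + r ^+ 2) by ring.
    have -> : c' * r * (8 * K) = 8 * c' * r * K by ring.
    lra.
  by rewrite ler_pM2l// mulr_gt0.
have C1 : 0 <= (1 + 2 / a) * (8 * c').
  by rewrite mulr_ge0 ?addr_ge0 ?divr_ge0 ?mulr_ge0 ?(ltW a0) ?(ltW c'0).
have C5 : 5 <= C by rewrite /C; lra.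
split.
- apply: (@le_trans _ _ (5 * (m + r))); first lra.
  by rewrite ler_wpM2r// addr_ge0// ltW.
- apply: (@le_trans _ _ (5 * (mh + r))); first lra.
  by rewrite ler_wpM2r// addr_ge0// ltW.
set M := Num.max _ _.
have M1 : r ^+ 2 <= M by rewrite le_max lexx.
have M2 : m * r <= M by rewrite le_max lexx orbT.
have M0 : 0 <= M by apply: le_trans M1; rewrite sqr_ge0.
(* Inserting [8 * K <= m + mh + r] into [mh <= 2 * m + 4 * K] gives [mh <= 5 * m + r]. *)
have mhr : mh * r <= (5 * m + r) * r by rewrite ler_pM2r//; lra.
have main3 : a / 2 * delta ^+ 2 + eps * K <= c' * (8 * M).
  apply: (le_trans main2); rewrite ler_pM2l//.
  by have : mh * r <= 5 * (m * r) + r ^+ 2; [move: mhr; nra|lra].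
have ek : 0 <= eps * K by apply: le_trans Er; rewrite !mulr_ge0 ?(ltW c'0) ?(ltW r0).
(* The factor [1 + 2 / a] restores the full [delta ^+ 2] from [a / 2 * delta ^+ 2]. *)
apply: (@le_trans _ _ ((1 + 2 / a) * (c' * (8 * M)))).
  apply: (@le_trans _ _ ((1 + 2 / a) * (a / 2 * delta ^+ 2 + eps * K))); last first.
    by rewrite ler_wpM2l// addr_ge0// divr_ge0// ltW.
  have -> : (1 + 2 / a) * (a / 2 * delta ^+ 2 + eps * K) =
      a / 2 * delta ^+ 2 + delta ^+ 2 + eps * K + 2 / a * (eps * K).
    by field; rewrite gt_eqF.
  have : 0 <= a / 2 * delta ^+ 2 by rewrite mulr_ge0 ?sqr_ge0// divr_ge0// ltW.
  have : 0 <= 2 / a * (eps * K) by rewrite mulr_ge0// divr_ge0// ltW.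
  lra.
have -> : (1 + 2 / a) * (c' * (8 * M)) = (1 + 2 / a) * (8 * c') * M by ring.
by rewrite ler_wpM2r// /C; lra.
Qed.

Lemma Lnorm2_marginal_sqr {R : realType} {dS dT : measure_display}
    {S : measurableType dS} {T : measurableType dT}
    (P : probability (S * T)%type R) (f : S -> R) :
  measurable_fun setT f -> bounded_measurable (fun z : S * T => f z.1) ->
  ('N[marginal P]_(2%:E) [EFin \o f] ^+ 2 =
   (l2norm P (fun z => f z.1) ^+ 2)%:E)%E.
Proof.
move=> mf bf.
suff -> : ('N[marginal P]_(2%:E) [EFin \o f] = (l2norm P (fun z => f z.1))%:E)%E by [].
rewrite unlock /=.
under eq_integral do rewrite powR_mulrn// real_normK ?num_real//.
rewrite /marginal ge0_integral_distribution; last 2 first.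
- by apply/measurable_EFinP; exact: measurable_funM.
- by move=> x; rewrite lee_fin sqr_ge0.
rewrite -[X in (X `^ _)%E]/((\int[P]_z (f z.1 ^+ 2)%:E)%E).
rewrite -EFin_mean; last exact: bounded_measurable_sqr.
by rewrite poweR_EFin powR12_sqrt// mean_ge0// => x; exact: sqr_ge0.
Qed.

Section Oracle.
Context {R : realType} {dS dT : measure_display}.
Context {S : measurableType dS} {T : measurableType dT}.
Variables (l : T -> R -> R) (N : nat) (h : 'I_N -> S -> R).
Hypothesis hl : loss_function l.
Hypothesis mh : forall j, measurable_fun setT (h j).
Hypothesis h1 : forall j x, `|h j x| <= 1.
Variables (B0 B1 B2 : R).
Hypothesis hB0 : forall y, l y 0 <= B0.
Hypothesis hB1 : forall y, `|loss_d1 l y 0| <= B1.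
Hypothesis hB2 : forall y u, `|loss_d2 l y u| <= B2.

Let B2_ge0 : 0 <= B2. Proof. exact: le_trans (hB2 point 0). Qed.

Lemma l1norm_simplex (lam : 'rV[R]_N) : simplex lam -> l1norm lam = 1.
Proof.
by move=> [l0 <-]; apply: eq_bigr => j _; rewrite ger0_norm.
Qed.

Lemma norm_mixture_simplex (lam : 'rV[R]_N) x : simplex lam -> `|mixture h lam x| <= 1.
Proof. by move=> sl; rewrite -(l1norm_simplex sl); exact: norm_mixture_le. Qed.

Lemma l1norm_simplexB (lam nu : 'rV[R]_N) : simplex lam -> simplex nu ->
  l1norm (nu - lam) <= 2.
Proof.
move=> sl sn; rewrite (le_trans (l1normD _ _))//.
by rewrite -scaleN1r l1normZ normrN1 mul1r !l1norm_simplex.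
Qed.

Lemma measurable_mixture (lam : 'rV[R]_N) : measurable_fun setT (mixture h lam).
Proof.
by apply: measurable_sum => j; apply: measurable_funM => //; exact: measurable_cst.
Qed.

(** Its product with [f_(nu - lam)], averaged, is the derivative of the risk at [lam] towards
    [nu]. *)
Definition gradient (lam : 'rV[R]_N) : S * T -> R :=
  loss_comp (loss_d1 l) (mixture h lam).

Lemma gradient_bound lam z : simplex lam -> `|gradient lam z| <= B1 + B2.
Proof.
by move=> sl; apply: (loss_d1_bound hl hB1 hB2); exact: norm_mixture_simplex.
Qed.

Lemma measurable_gradient lam : measurable_fun setT (gradient lam).
Proof.
apply: (measurable_loss_d1 hl) => //.
exact: measurableT_comp (measurable_mixture lam) measurable_fst.
Qed.

Lemma bounded_measurable_gradient lam : simplex lam ->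
  bounded_measurable (gradient lam).
Proof.
move=> sl; split; first exact: measurable_gradient.
by exists (B1 + B2) => z; exact: gradient_bound.
Qed.

Lemma bounded_measurable_loss lam : simplex lam ->
  bounded_measurable (loss_comp l (mixture h lam)).
Proof.
move=> sl; split; last first.
  exists (B0 + B1 + B2) => z; apply: (loss_bound hl hB0 hB1 hB2).
  exact: norm_mixture_simplex.
apply: (measurableT_comp (loss_measurable hl)
    (g := fun z : S * T => (z.2, mixture h lam z.1))).
apply/measurable_fun_pairP; split; first exact: measurable_snd.
exact: measurableT_comp (measurable_mixture lam) measurable_fst.
Qed.

(** The constant is [4 * B2] because [f_(nu - lam)] is at most 2 in absolute value. *)
Lemma loss_tangent_upper_segment (lam nu : 'rV[R]_N) t z :
  simplex lam -> simplex nu ->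
  loss_comp l (mixture h (lam + t *: (nu - lam))) z <=
  loss_comp l (mixture h lam) z +
  t * (gradient lam z * mixture_pair h (nu - lam) z) + 4 * B2 * t ^+ 2.
Proof.
move=> sl sn; rewrite /loss_comp mixtureD mixtureZ.
have := loss_tangent_upper hl hB2 z.2 (mixture h lam z.1)
  (mixture h lam z.1 + t * mixture h (nu - lam) z.1).
rewrite (_ : forall u v : R, u + v - u = v); last by move=> ? ?; ring.
move=> /le_trans; apply.
rewrite /gradient /loss_comp /mixture_pair; set v := mixture h (nu - lam) z.1.
have v2 : v ^+ 2 <= 4.
  have : `|v| <= 2.
    by rewrite (le_trans (norm_mixture_le h1 _ _))// l1norm_simplexB.
  rewrite -[v ^+ 2]real_normK ?num_real//; have := normr_ge0 v; nra.
have : B2 * t ^+ 2 * v ^+ 2 <= B2 * t ^+ 2 * 4.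
  by rewrite ler_wpM2l// mulr_ge0// sqr_ge0.
rewrite exprMn; lra.
Qed.

Section Population.
Variable P : probability (S * T)%type R.

Lemma risk_fin lam : simplex lam ->
  risk P l (mixture h lam) = (\int[P]_z loss_comp l (mixture h lam) z)%:E.
Proof. by move=> sl; rewrite EFin_mean//; exact: bounded_measurable_loss. Qed.

Let risk_real (lam : 'rV[R]_N) : R := \int[P]_z loss_comp l (mixture h lam) z.

(** Integrating the pointwise quadratic bound takes the place of differentiation under the integral
    sign. *)
Lemma population_tangent_upper lam nu : simplex lam -> simplex nu ->
  tangent_upper risk_real lam nu
    (\int[P]_z (gradient lam z * mixture_pair h (nu - lam) z)) (4 * B2).
Proof.
move=> sl sn t t0 t1; have st := simplex_segment sl sn t0 t1.
have bl := bounded_measurable_loss sl.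
have bg : bounded_measurable (fun z => gradient lam z * mixture_pair h (nu - lam) z).
  apply: bounded_measurableM; first exact: bounded_measurable_gradient.
  exact: bounded_measurable_mixture.
have btg := bounded_measurableZ t bg.
have bc := bounded_measurable_cst (T := (S * T)%type) (4 * B2 * t ^+ 2).
rewrite /risk_real -meanZ// -meanD// -[X in _ <= _ + X](mean_cst P) -meanD//; last first.
  exact: bounded_measurableD.
apply: le_mean.
- exact: bounded_measurable_loss.
- by do 2 apply: bounded_measurableD => //.
- by move=> z; exact: loss_tangent_upper_segment.
Qed.

Lemma empirical_tangent_upper n (z : 'I_n -> S * T) lam nu : (0 < n)%N ->
  simplex lam -> simplex nu ->
  tangent_upper (fun mu => empirical_mean z (loss_comp l (mixture h mu))) lam nu
    (empirical_mean z (fun x => gradient lam x * mixture_pair h (nu - lam) x))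
    (4 * B2).
Proof.
move=> n0 sl sn t t0 t1; rewrite /empirical_mean.
have n0' : 0 < n%:R :> R by rewrite ltr0n.
rewrite -(ler_pM2l n0') !mulrDr mulrA divff ?gt_eqF// mul1r.
rewrite [X in _ <= _ + X + _]mulrCA !mulVKf ?gt_eqF//.
apply: (@le_trans _ _ (\sum_(i < n) (loss_comp l (mixture h lam) (z i) +
  t * (gradient lam (z i) * mixture_pair h (nu - lam) (z i)) + 4 * B2 * t ^+ 2))).
  by apply: ler_sum => i _; exact: loss_tangent_upper_segment.
by rewrite !big_split/= -mulr_sumr sumr_const card_ord [n%:R * _]mulr_natl.
Qed.

(** Each first-order condition is tested at the other minimizer and the two are added: the entropy
    terms combine into [- eps * K], and strong monotonicity of the derivative on the sample produces
    the quadratic term. *)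
Lemma minimizers_basic_inequality n (z : 'I_n -> S * T) eps (lamhat lam : 'rV[R]_N) :
  (0 < n)%N -> (0 < N)%N -> 0 < eps ->
  is_argmin_simplex (penalized_empirical_risk z l h eps) lamhat ->
  is_argmin_simplex (penalized_risk P l h eps) lam ->
  let w := lamhat - lam in
  let K := \sum_j w ord0 j * (ln (lamhat ord0 j) - ln (lam ord0 j)) in
  [/\ forall j, 0 < lamhat ord0 j, forall j, 0 < lam ord0 j &
    2 * tau l 1 * l2norm P (mixture_pair h w) ^+ 2 + eps * K <=
    `|deviation P z (fun x => gradient lam x * mixture_pair h w x)| +
    2 * `|tau l 1| * `|deviation P z (fun x => mixture_pair h w x ^+ 2)| ].
Proof.
move=> n0 N0 eps0 [sh minh] [sl minl] w K.
have n0' : 0 < n%:R :> R by rewrite ltr0n.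
pose Gn (mu : 'rV[R]_N) := empirical_mean z (loss_comp l (mixture h mu)).
have minh' nu : simplex nu ->
    Gn lamhat + eps * neg_entropy lamhat <= Gn nu + eps * neg_entropy nu.
  by move=> sn; have := minh nu sn; rewrite lee_fin.
have minl' nu : simplex nu ->
    risk_real lam + eps * neg_entropy lam <= risk_real nu + eps * neg_entropy nu.
  by move=> sn; have := minl nu sn; rewrite /penalized_risk !risk_fin// -!EFinD lee_fin.
(* The uniform weights are the positive competitor required by [minimizer_gt0]. *)
pose unif : 'rV[R]_N := \row_j N%:R^-1.
have unif0 j : 0 < unif ord0 j by rewrite mxE invr_gt0 ltr0n.
have su : simplex unif.
  split=> [j|]; first exact: ltW.
  under eq_bigr do rewrite mxE.
  by rewrite sumr_const card_ord -[LHS]mulr_natl divff// pnatr_eq0 -lt0n.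
have cB : 0 <= 4 * B2 by rewrite mulr_ge0.
have lamhat0 := minimizer_gt0 eps0 sh minh' su unif0 (empirical_tangent_upper z n0 sh su) cB.
have lam0 := minimizer_gt0 eps0 sl minl' su unif0 (population_tangent_upper sl su) cB.
split => //.
have FO1 := minimizer_first_order eps0 sh minh' sl lamhat0 (empirical_tangent_upper z n0 sh sl).
have FO2 := minimizer_first_order eps0 sl minl' sh lam0 (population_tangent_upper sl sh).
rewrite -/w in FO2.
have bf : bounded_measurable (mixture_pair h w : S * T -> R) by exact: bounded_measurable_mixture.
have bf2 := bounded_measurable_sqr bf.
have bg : bounded_measurable (fun x => gradient lam x * mixture_pair h w x).
  by apply: bounded_measurableM => //; exact: bounded_measurable_gradient.
pose En (Y : S * T -> R) := n%:R^-1 * \sum_(i < n) Y (z i).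
have strong : 2 * tau l 1 * En (fun x => mixture_pair h w x ^+ 2) <=
    - En (fun x => gradient lamhat x * mixture_pair h (lam - lamhat) x)
    - En (fun x => gradient lam x * mixture_pair h w x).
  rewrite /En mulrCA -!mulrN -mulrDr ler_pM2l ?invr_gt0//.
  rewrite mulr_sumr -!sumrN -big_split/=; apply: ler_sum => i _.
  have := loss_d1_strongly_monotone hl (z i).2
    (norm_mixture_simplex (z i).1 sl) (norm_mixture_simplex (z i).1 sh).
  rewrite /mixture_pair /w !mixtureB /gradient /loss_comp; lra.
have devg : \int[P]_x (gradient lam x * mixture_pair h w x) =
    En (fun x => gradient lam x * mixture_pair h w x) -
    deviation P z (fun x => gradient lam x * mixture_pair h w x).
  by rewrite /deviation opprB addrC subrK.
have devq : l2norm P (mixture_pair h w) ^+ 2 =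
    En (fun x => mixture_pair h w x ^+ 2) -
    deviation P z (fun x => mixture_pair h w x ^+ 2).
  by rewrite l2norm_sqr /deviation opprB addrC subrK.
have KE : eps * K = - (eps * \sum_j (lam ord0 j - lamhat ord0 j) * ln (lamhat ord0 j))
   - eps * \sum_j (lamhat ord0 j - lam ord0 j) * ln (lam ord0 j).
  rewrite -!mulrN -mulrDr -!sumrN -big_split/=; congr (_ * _); apply: eq_bigr => j _.
  by rewrite !mxE; ring.
rewrite KE devq mulrBr.
set Q := deviation P z (fun x => mixture_pair h w x ^+ 2).
set L := deviation P z _ in devg *.
have HQ : - (2 * tau l 1 * Q) <= 2 * `|tau l 1| * `|Q|.
  by have := ler_norm (- (tau l 1 * Q)); rewrite normrN normrM; lra.
have HL : - L <= `|L| by rewrite -normrN ler_norm.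
move: FO1 FO2 strong HQ HL; rewrite devg -[empirical_mean _ _]/(En _).
move: (En _) (En _) (En _) => E1 E2 E3.
lra.
Qed.

End Population.
End Oracle.

Unset Implicit Arguments.

Theorem theorem1 (R : realType) (dT : measure_display) (T : measurableType dT)
    (l : T -> R -> R) (hl : loss_function l) :
  exists D C : R, [/\ 0 < D, 0 < C &
    forall (dS dO : measure_display) (S : measurableType dS)
      (Omega : measurableType dO) (Pr : probability Omega R)
      (P : probability (S * T)%type R)
      (fstar : S -> R) (M : R), bayes_condition P l fstar M ->
    forall (n N : nat) (gamma : R),
      (0 < n)%N -> 0 < gamma -> ln (n%:R : R) `^ gamma <= N%:R ->
    forall (Z : 'I_n -> {RV Pr >-> (S * T)%type}), iid_sample P Z ->
    forall (h : 'I_N -> S -> R),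
      (forall j, measurable_fun setT (h j)) ->
      (forall j x, -1 <= h j x <= 1) ->
    forall (J : {set 'I_N}) (A eps : R),
      let rate := (#|J|%:R + A * ln N%:R) / n%:R in
      1 <= A -> D * Num.sqrt rate <= eps ->
    forall (lamhat : Omega -> 'rV[R]_N) (lam : 'rV[R]_N),
      (forall w, is_argmin_simplex
         (penalized_empirical_risk (fun i => Z i w) l h eps) (lamhat w)) ->
      is_argmin_simplex (penalized_risk P l h eps) lam ->
    with_probability_ge Pr (1 - N%:R `^ (- A)) (fun w =>
      [/\ mass_outside J (lamhat w) <=
            C * (mass_outside J lam + Num.sqrt rate),
          mass_outside J lam <=
            C * (mass_outside J (lamhat w) + Num.sqrt rate) &
          ('N[marginal P]_(2%:E)
               [EFin \o (mixture h (lamhat w) \- mixture h lam)%R] ^+ 2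
             + eps%:E * sym_KL (lamhat w) lam
           <= (C * Num.max rate (mass_outside J lam * Num.sqrt rate))%:E)%E])].
Proof.
have [B0 hB0] := loss_at0_bounded hl.
have [B1 hB1] := loss_d1_at0_bounded hl.
have [B2 hB2] := loss_d2_bounded hl.
(* The constants are fixed before [M]. If [tau l 1] is not positive, monotonicity of [tau]
   contradicts [bayes_condition] for every [M], so any constants do. *)
have [tau0|tau0] := leP (tau l 1) 0.
  exists 1, 1; split => // dS dO S Omega Pr P fstar M [_ _ _ tauM].
  have : tau l (Num.max M 1) <= tau l 1 by apply: (tau_anti hl) => //; rewrite le_max lexx orbT.
  by move=> /(lt_le_trans tauM) /lt_le_trans /(_ tau0); rewrite ltxx.
pose b := B1 + B2 + 1.
have b1 : 1 <= b.
  by rewrite /b lerDr addr_ge0//; [exact: le_trans (hB1 point)|exact: le_trans (hB2 point 0)].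
pose a := 2 * tau l 1.
have a0 : 0 < a by exact: mulr_gt0.
(* The linear deviation contributes [300 * b], and the quadratic one twice as much, weighted by
   [a]. *)
pose c := 300 * b * (1 + 2 * a).
have c0 : 0 < c by rewrite !mulr_gt0//; lra.
pose c' := c + c ^+ 2 / (2 * a).
have c'0 : 0 < c' by rewrite addr_gt0// divr_gt0 ?exprn_gt0// mulr_gt0.
exists (8 * c'), (5 + (1 + 2 / a) * (8 * c')); split.
- exact: mulr_gt0.
- by rewrite addr_gt0// mulr_gt0 ?mulr_gt0// addr_gt0// divr_gt0.
move=> dS dO S Omega Pr P fstar M _ n N gamma n0 _ _ Z iidZ h mh h1' J A eps rate
  A1 epsD lamhat lam minhat minlam.
have h1 j x : `|h j x| <= 1 by rewrite ler_norml h1'.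
(* For [N = 0] the simplex is empty; for [N = 1] the required probability is 0 and the empty event
   suffices. *)
have [N1|N1] := ltnP 1 N; last first.
  case: N h {mh h1' h1} J rate epsD lamhat lam minhat minlam N1 =>
    [|[|//]] h J rate _ lamhat lam _ minlam _.
    by have [[_]] := minlam; rewrite big_ord0 => /esym/eqP; rewrite oner_eq0.
  exists set0; split => //.
  by rewrite measure0 powR1 subrr.
have lnN : 0 < ln N%:R :> R by rewrite ln_gt0// ltr1n.
have rate0 : 0 < rate.
  rewrite /rate divr_gt0 ?ltr0n//; apply: ltr_wpDl => //.
  by rewrite mulr_gt0//; lra.
set r := Num.sqrt rate in epsD *.
have r0 : 0 < r by rewrite sqrtr_gt0.
have eps0 : 0 < eps by apply: lt_le_trans epsD; rewrite !mulr_gt0.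
have sl := minlam.1.
have gb z : `|gradient l h lam z| <= b.
  by rewrite (le_trans (gradient_bound hl h1 hB1 hB2 z sl))// /b; lra.
have mg := measurable_gradient hl mh lam.
apply: with_probability_ge_le
  (linear_quadratic_deviation J n0 iidZ mh h1 mg gb b1 N1 A1) => //.
(* From here on the outcome [om] is fixed and the argument is deterministic. *)
move=> om /(_ (lamhat om - lam)); set w := _ - lam.
have sh := (minhat om).1.
move=> /(_ (l1norm_simplexB sl sh)) []; rewrite -/rate -/r => devg devq.
have [lamhat0 lam0 basic] :=
  minimizers_basic_inequality hl mh h1 hB0 hB1 hB2 n0 (ltnW N1) eps0 (minhat om) minlam.
rewrite -/w in basic.
set delta := l2norm P (mixture_pair h w) in devg devq basic.
set Delta := outside_l1norm J w in devg devq.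
set K := \sum_j _ in basic.
have KE : K = \sum_j (lamhat om ord0 j - lam ord0 j) *
    (ln (lamhat om ord0 j) - ln (lam ord0 j)).
  by apply: eq_bigr => j _; rewrite !mxE.
have K0 : 0 <= K by rewrite KE; apply: sumr_ge0 => j _; exact: sym_kl_term_ge0.
(* The entrywise comparison is summed outside [J]; the terms of the divergence inside [J] are
   nonnegative and may be added. *)
have mass_le (x y : 'rV[R]_N) : (forall j, 0 < x ord0 j) -> (forall j, 0 < y ord0 j) ->
    mass_outside J x <= 2 * mass_outside J y +
      4 * \sum_j (x ord0 j - y ord0 j) * (ln (x ord0 j) - ln (y ord0 j)).
  move=> x0 y0; apply: (@le_trans _ _ (2 * mass_outside J y + 4 *
      \sum_(j | j \notin J) (x ord0 j - y ord0 j) * (ln (x ord0 j) - ln (y ord0 j)))).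
    rewrite /mass_outside !mulr_sumr -big_split/=; apply: ler_sum => j _.
    exact: le_double_add_sym_kl.
  rewrite lerD2l ler_pM2l// [leRHS](bigID (fun j => j \notin J))/= lerDl.
  by apply: sumr_ge0 => j _; exact: sym_kl_term_ge0.
have mass0 (x : 'rV[R]_N) : (forall j, 0 < x ord0 j) -> 0 <= mass_outside J x.
  by move=> x0; apply: sumr_ge0 => j _; exact: ltW.
have DeltaE : Delta <= mass_outside J lam + mass_outside J (lamhat om).
  rewrite /Delta /outside_l1norm /mass_outside -big_split/=; apply: ler_sum => j _.
  rewrite !mxE (le_trans (ler_normB _ _))// !gtr0_norm// addrC//.
have main : a * delta ^+ 2 + eps * K <= c * ((delta + Delta) * r + r ^+ 2).
  apply: (le_trans basic); rewrite (gtr0_norm tau0) -/a.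
  have := ler_wpM2l (ltW a0) devq.
  have -> : c * ((delta + Delta) * r + r ^+ 2) =
    300 * b * ((delta + Delta) * r + r ^+ 2) + a * (2 * (300 * b * ((delta + Delta) * r + r ^+ 2))).
    by rewrite /c; ring.
  lra.
have hm := mass_le _ _ lamhat0 lam0; rewrite -KE in hm.
have hmh := mass_le _ _ lam0 lamhat0.
have KE' : \sum_j (lam ord0 j - lamhat om ord0 j) *
    (ln (lam ord0 j) - ln (lamhat om ord0 j)) = K.
  by rewrite KE; apply: eq_bigr => j _; ring.
rewrite KE' in hmh.
have [C1 C2 C3] := oracle_algebra a0 c0 r0 (l2norm_ge0 _ _) (mass0 _ lam0)
  (mass0 _ lamhat0) K0 DeltaE main epsD hm hmh.
split => //.
rewrite sym_KL_fin// -KE.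
have fE : (fun z : S * T => (mixture h (lamhat om) \- mixture h lam) z.1) =
    mixture_pair h w.
  by apply/funext => z; rewrite /mixture_pair mixtureB.
rewrite Lnorm2_marginal_sqr.
- rewrite fE -/delta -EFinM -EFinD lee_fin.
  by rewrite -[X in Num.max X _](sqr_sqrtr (ltW rate0)); exact: C3.
- by apply: measurable_funB; exact: measurable_mixture.
- by rewrite fE; exact: bounded_measurable_mixture.
Qed.
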